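(* Let $H$ be a separable infinite dimensional complex Hilbert space. Then the set $$\{T\in\mathcal{B}(H):\ \sigma_c(T)\neq\emptyset\}$$ is co-meager in $\mathcal{B}(H)$ with respect to the operator norm topology.
   Context: $\mathcal{B}(H)$ is the algebra of bounded linear operators on $H$, $\sigma(T)$ is the spectrum of $T$, and the point spectrum $\sigma_p(T)$ is the set of all $\lambda\in\mathbb{C}$ with $\ker(T-\lambda\,\mathrm{id}_H)\neq\{0\}$. The continuous spectrum is $\sigma_c(T)=\sigma(T)\setminus\big(\sigma_p(T)\cup\overline{\sigma_p(T^* )}\big)$, where $T^*$ is the adjoint of $T$ and the bar denotes complex conjugation of the elements, $\overline{\sigma_p(T^* )}=\{\bar\mu:\mu\in\sigma_p(T^* )\}$. Equivalently, $\lambda\in\sigma_c(T)$ if and only if $\ker(T-\lambda\,\mathrm{id}_H)=\ker(T^*-\bar\lambda\,\mathrm{id}_H)=\{0\}$ and the image of $T-\lambda\,\mathrm{id}_H$ is not closed. A subset of a Baire space is co-meager if it contains a dense $G_\delta$-set. *)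

(* Defs.v *)
From HB Require Import structures.
From mathcomp Require Import all_boot all_order all_algebra.
From mathcomp Require Import sesquilinear.
From mathcomp Require Import complex.
From mathcomp Require Import all_classical all_reals all_analysis.
From mathcomp Require Import borel_hierarchy.
From mathcomp Require Import ring lra.

Set Implicit Arguments.
Unset Strict Implicit.
Unset Printing Implicit Defensive.

Import Order.TTheory GRing.Theory Num.Theory Num.Def.
Import numFieldNormedType.Exports.

Local Open Scope classical_set_scope.
Local Open Scope complex_scope.
Local Open Scope ring_scope.

(* A complex Hilbert space: a Banach space over R[i] whose norm comes from an
   inner product, linear in the first variable. Norms of normed modules over
   R[i] take their (real, nonnegative) values in R[i]. *)
HB.mixin Record isHilbert (R : realType) H & CompleteNormedModule R[i] H := {
  inner : {dot H for @Num.conj R[i]};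
  inner_normE : forall x : H, inner x x = `|x| ^+ 2
}.

#[short(type="hilbertType")]
HB.structure Definition Hilbert (R : realType) :=
  {H of CompleteNormedModule R[i] H & isHilbert R H}.

Definition separable_space (T : topologicalType) :=
  exists2 A : set T, countable A & dense A.

Definition infinite_dimensional (K : fieldType) (V : lmodType K) :=
  forall (n : nat) (e : 'I_n -> V),
    exists x : V, forall c : 'I_n -> K, x != \sum_(i < n) c i *: e i.

Definition comeager (T : topologicalType) (A : set T) :=
  exists2 G : set T, Gdelta G /\ dense G & G `<=` A.

Section bounded_operators.
Context (R : realType) (V : normedModType R[i]).

Definition bounded_linear : {pred V -> V} := fun T =>
  `[< linear T /\ exists M : R[i], forall x, `|T x| <= M * `|x| >].

Fact bounded_linear_submod_closed : submod_closed bounded_linear.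
Proof.
split.
  apply/asboolP; split; first by move=> a u v /=; rewrite [RHS]addr0 scaler0.
  by exists 0 => x; rewrite mul0r normr0.
move=> a f g /asboolP[lf [M Mf]] /asboolP[lg [N Ng]].
apply/asboolP; split.
  move=> b x y; rewrite !fctE lf lg !scalerDr !scalerA (mulrC a b).
  by rewrite addrACA.
exists (`|a| * M + N) => x.
rewrite fctE (le_trans (ler_normD _ _))// mulrDl.
by rewrite lerD// normrZ -mulrA ler_wpM2l.
Qed.

HB.instance Definition _ := GRing.isSubmodClosed.Build R[i] (V -> V)
  bounded_linear bounded_linear_submod_closed.

Record boundedOp := BoundedOp {
  boundedOp_fun :> V -> V;
  boundedOp_subproof : boundedOp_fun \in bounded_linear
}.

HB.instance Definition _ := [isSub for boundedOp_fun].
HB.instance Definition _ := [Choice of boundedOp by <:].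
HB.instance Definition _ := [SubChoice_isSubLmodule of boundedOp by <:].

Implicit Types (S T : boundedOp) (x y : V).

Fact boundedOp_linear T : linear T.
Proof. by have /asboolP[] := boundedOp_subproof T. Qed.

HB.instance Definition _ T :=
  GRing.isLinear.Build R[i] V V *:%R T (boundedOp_linear T).

Lemma boundedOp_bounded T : exists M : R[i], forall x, `|T x| <= M * `|x|.
Proof. by have /asboolP[] := boundedOp_subproof T. Qed.

Lemma boundedOpP S T : (forall x, S x = T x) -> S = T.
Proof. by move=> ST; apply/val_inj/funext. Qed.

Lemma boundedOpD S T x : (S + T) x = S x + T x. Proof. by []. Qed.
Lemma boundedOpN T x : (- T) x = - T x. Proof. by []. Qed.
Lemma boundedOpB S T x : (S - T) x = S x - T x. Proof. by []. Qed.
Lemma boundedOpZ a T x : (a *: T) x = a *: T x. Proof. by []. Qed.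
Lemma boundedOp0 x : (0 : boundedOp) x = 0. Proof. by []. Qed.

Fact idOp_subproof : (@idfun V : V -> V) \in bounded_linear.
Proof. by apply/asboolP; split=> //; exists 1 => x; rewrite mul1r. Qed.

Definition idOp := BoundedOp idOp_subproof.

(* As norms have their values in R[i], the supremum is taken over real parts. *)
Definition opNorm T : R :=
  sup [set complex.Re `|T x| | x in [set x : V | `|x| <= 1]].

Let nrm (U : normedModType R[i]) (x : U) : R := complex.Re `|x|.

Let nrmE (U : normedModType R[i]) (x : U) : `|x| = (nrm x)%:C.
Proof. by rewrite /nrm RRe_real. Qed.

Lemma opNorm_ge T x : `|T x| <= (opNorm T)%:C * `|x|.
Proof.
have [->|x0] := eqVneq x 0; first by rewrite linear0 !normr0 mulr0.
have nx0 : 0 < `|x| by rewrite normr_gt0.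
rewrite -ler_pdivrMr//.
have -> : `|T x| / `|x| = `|T (`|x|^-1 *: x)|.
  by rewrite linearZ/= normrZ normrV ?unitfE ?gt_eqF// normr_id mulrC.
rewrite nrmE lecR; apply: sup_upper_bound; last first.
  exists (`|x|^-1 *: x) => //=.
  by rewrite normrZ normrV ?unitfE ?gt_eqF// normr_id mulVf ?gt_eqF.
split; first by exists (nrm (T 0)); exists 0 => //=; rewrite normr0.
have [M MT] := boundedOp_bounded T.
have M0 : 0 <= M.
  by have := le_trans (normr_ge0 _) (MT x); rewrite pmulr_lge0.
exists (complex.Re M) => _ [y /= y1 <-].
rewrite -lecR -nrmE RRe_real ?ger0_real// (le_trans (MT y))//.
by rewrite -[leRHS]mulr1 ler_wpM2l.
Qed.

Lemma opNorm_le T (M : R) : 0 <= M ->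
  (forall x, `|T x| <= M%:C * `|x|) -> opNorm T <= M.
Proof.
move=> M0 MT; apply: ge_sup.
  by exists (nrm (T 0)); exists 0 => //=; rewrite normr0.
move=> _ [y /= y1 <-]; rewrite -lecR -nrmE (le_trans (MT y))//.
by rewrite -[leRHS]mulr1 ler_wpM2l// lecR.
Qed.

Lemma opNorm_ge0 T : 0 <= opNorm T.
Proof.
have [[x x0]|V0] := pselect (exists x : V, x != 0).
  have nx0 : 0 < `|x| by rewrite normr_gt0.
  have := le_trans (normr_ge0 _) (opNorm_ge T x).
  by rewrite pmulr_lge0// lecR.
rewrite /opNorm (_ : [set _ | _ in _] = [set 0]) ?sup1//.
apply/seteqP; split => [_ [x _ <-]|_ ->] /=.
  have [->|Tx0] := eqVneq (T x) 0; last by case: V0; exists (T x).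
  by rewrite normr0.
by exists 0; rewrite /= ?linear0 normr0.
Qed.

Fact opNormD S T :
  (opNorm (S + T))%:C <= (opNorm S)%:C + (opNorm T)%:C :> R[i].
Proof.
rewrite -rmorphD lecR opNorm_le ?addr_ge0 ?opNorm_ge0// => x.
by rewrite (le_trans (ler_normD _ _))// rmorphD mulrDl lerD// opNorm_ge.
Qed.

Let opNormZ_le a T : (opNorm (a *: T))%:C <= `|a| * (opNorm T)%:C :> R[i].
Proof.
have [r r0 ar] : exists2 r : R, 0 <= r & `|a| = r%:C.
  exists (complex.Re `|a|); last by rewrite RRe_real.
  by have := normr_ge0 a; rewrite lecE => /andP[].
rewrite ar -rmorphM lecR opNorm_le ?mulr_ge0 ?opNorm_ge0// => x.
rewrite boundedOpZ normrZ ar rmorphM -mulrA.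
by rewrite ler_wpM2l ?opNorm_ge// lecR.
Qed.

Fact opNorm_eq0 T : (opNorm T)%:C = 0 :> R[i] -> T = 0.
Proof.
move=> T0; apply: boundedOpP => x; apply/eqP; rewrite -normr_le0.
by rewrite (le_trans (opNorm_ge _ _))// T0 mul0r.
Qed.

Fact opNormZ a T : (opNorm (a *: T))%:C = `|a| * (opNorm T)%:C :> R[i].
Proof.
apply/eqP; rewrite eq_le opNormZ_le/=.
have [->|a0] := eqVneq a 0; first by rewrite normr0 mul0r lecR opNorm_ge0.
rewrite -ler_pdivlMl ?normr_gt0// -normfV.
by have := opNormZ_le a^-1 (a *: T); rewrite scalerA mulVf// scale1r.
Qed.

HB.instance Definition _ := @Lmodule_isNormed.Build R[i] boundedOp
  (fun T => (opNorm T)%:C) opNormD opNormZ opNorm_eq0.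

Lemma opNormE T : `|T| = (opNorm T)%:C. Proof. by []. Qed.

End bounded_operators.

Notation "''B' ( H )" := (boundedOp H) (format "''B' ( H )") : type_scope.

Section adjoint.
Context (R : realType) (H : hilbertType R).
Implicit Types (x y z : H) (S T : 'B(H)).

Local Notation "''[' x , y ]" := (inner x y) : ring_scope.

Lemma innerC x y : '[x, y] = ('[y, x])^*%R.
Proof. by rewrite hermC expr0 mul1r. Qed.

Lemma inner_CauchySchwarz x y : `|'[x, y]| <= `|x| * `|y|.
Proof.
have [->|y0] := eqVneq y 0; first by rewrite linear0r normr0 mulr_ge0.
have yy0 : 0 < '[y, y] by rewrite neq0_dnorm_gt0.
have yyV : '[y, y]^* = '[y, y] by rewrite -innerC.
rewrite -(@ler_pXn2r _ 2)// ?nnegrE ?mulr_ge0// exprMn -!inner_normE.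
rewrite -subr_ge0 -(pmulr_rge0 _ yy0).
have := dnorm_ge0 inner ('[y, y] *: x - '[x, y] *: y).
rewrite dnormB !dnormZ linearZl_LR linearZr_LR/= (ger0_norm (ltW yy0)) normCK.
rewrite !rmorphM/= !conjCK yyV -innerC => /le_trans; apply.
by rewrite le_eqVlt; apply/orP; left; apply/eqP; ring.
Qed.

Lemma inner_extl x y : (forall z, '[z, x] = '[z, y]) -> x = y.
Proof.
move=> xy; apply/eqP; rewrite -subr_eq0 -(dnorm_eq0 inner).
by rewrite linearBr/= xy subrr.
Qed.

(* For a bounded linear form f, the functional J x = |x|^2 - 2 Re (f x) is
   bounded below, and its minimizing sequences converge to the vector
   representing f. *)
Section riesz.
Context (f : H -> R[i]) (lf : scalar f).
Context (M : R) (fM : forall x, `|f x| <= M%:C * `|x|).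

Let J x : R := complex.Re '[x, x] - complex.Re (f x) *+ 2.

Let JE x : (J x)%:C = '[x, x] - (f x + (f x)^*%R).
Proof.
rewrite /J rmorphB rmorphMn/= RRe_real ?ger0_real ?dnorm_ge0//.
by rewrite addcJ mulr_natl.
Qed.

Let J_ge x : - M ^+ 2 <= J x.
Proof.
have [n n0 xn] : exists2 n : R, 0 <= n & `|x| = n%:C.
  exists (complex.Re `|x|); last by rewrite RRe_real.
  by have := normr_ge0 x; rewrite lecE => /andP[].
have fn : complex.Re (f x) <= M * n.
  rewrite (le_trans (ler_norm _))// -lecR (le_trans (normc_ge_Re _))//.
  by rewrite rmorphM/= -xn fM.
rewrite /J inner_normE xn -rmorphXn/=.
have := sqr_ge0 (n - M); lra.
Qed.

Let d := inf (range J).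

Let d_le x : d <= J x.
Proof.
apply: ge_inf; last by exists x.
by exists (- M ^+ 2) => _ [y _ <-]; exact: J_ge.
Qed.

Let JD x z : z != 0 -> let w := '[z, x] - f z in
  (J (x - (w^*%R / '[z, z]) *: z))%:C = (J x)%:C - `|w| ^+ 2 / '[z, z].
Proof.
move=> z0 w; have zz0 : '[z, z] != 0 by rewrite dnorm_eq0.
have zzJ : ('[z, z])^*%R = '[z, z] by rewrite -innerC.
have fL a u v : f (u - a *: v) = f u - a * f v.
  by rewrite addrC -scaleNr lf mulNr addrC.
rewrite !JE fL dnormB dnormZ linearZr_LR/= !normCK /w.
rewrite !(rmorphM, rmorphB, fmorphV)/= !conjCK !zzJ (innerC x z) !conjCK.
by field.
Qed.

Let minimizer (e : R) : 0 < e ->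
  exists x, forall z, `|'[z, x] - f z| <= e%:C * `|z|.
Proof.
have Jinf : has_inf (range J).
  split; first by exists (J 0), 0.
  by exists (- M ^+ 2) => _ [y _ <-]; exact: J_ge.
move=> e0; have [_ [x _ <-] xd] := inf_adherent (exprn_gt0 2 e0) Jinf.
exists x => z; have [->|z0] := eqVneq z 0.
  rewrite linear0l (_ : f 0 = 0) ?subrr ?normr0 ?mulr0//.
  by have := lf (-1) 0 0; rewrite scaler0 addr0 mulN1r addNr.
have zz0 : 0 < '[z, z] by rewrite neq0_dnorm_gt0.
rewrite -(@ler_pXn2r _ 2)// ?nnegrE ?mulr_ge0 ?lecR ?(ltW e0)//.
rewrite exprMn -inner_normE -ler_pdivrMr//.
have := d_le (x - (('[z, x] - f z)^*%R / '[z, z]) *: z).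
rewrite -lecR JD// lerBrDr addrC -lerBrDr => /le_trans; apply.
by rewrite -rmorphB -rmorphXn lecR lerBlDl ltW.
Qed.

Lemma riesz_representation : exists y, forall x, f x = '[x, y].
Proof.
have /choice[u uf] : forall n, exists x, forall z,
    `|'[z, x] - f z| <= (n.+1%:R^-1 : R)%:C * `|z|.
  by move=> n; exact: minimizer.
have uB n m : `|u n - u m| <= (n.+1%:R^-1 + m.+1%:R^-1 : R)%:C.
  have [->|unm] := eqVneq (u n - u m) 0.
    by rewrite normr0 lecR addr_ge0.
  have nu0 : 0 < `|u n - u m| by rewrite normr_gt0.
  rewrite -(ler_pM2r nu0) -expr2 -inner_normE linearBr/=.
  rewrite -[leLHS]ger0_norm; last by rewrite -linearBr dnorm_ge0.
  set z := u n - u m.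
  rewrite [X in `|X|](_ : _ = ('[z, u n] - f z) - ('[z, u m] - f z)); last first.
    by ring.
  rewrite (le_trans (ler_normB _ _))// rmorphD mulrDl.
  exact: lerD (uf _ _) (uf _ _).
have posC (e : R[i]) : 0 < e -> exists2 r : R, 0 < r & e = r%:C.
  move=> e0; exists (complex.Re e); last by rewrite RRe_real// gtr0_real.
  by move: e0; rewrite ltcE => /andP[].
have inv_small (r : R) : 0 < r -> \forall n \near \oo, n.+1%:R^-1 < r.
  by move=> r0; exact: near_infty_natSinv_lt (PosNum r0).
have cu : cvgn u.
  apply: cauchy_cvg; apply/cauchy_exP => _ /posC[r r0 ->].
  have r20 : 0 < r / 2 by rewrite divr_gt0.
  have [N _ Nr] := inv_small _ r20.
  exists (u N); exists N => //= n Nn.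
  rewrite -ball_normE/= (le_lt_trans (uB _ _))// ltcR (splitr r).
  by rewrite ltrD// Nr//=.
have bnd x (r : R) : 0 < r -> `|'[x, limn u] - f x| <= (r * 2)%:C * `|x|.
  move=> r0; near \oo => n.
  rewrite (_ : _ - _ = '[x, limn u - u n] + ('[x, u n] - f x)); last first.
    by rewrite linearBr/=; ring.
  rewrite (le_trans (ler_normD _ _))// mulr_natr mulr2n rmorphD mulrDl lerD//.
    rewrite (le_trans (inner_CauchySchwarz _ _))// mulrC ler_wpM2r// ltW//.
    by near: n; apply: (@cvgr_dist_lt _ _ _ \oo _ u (limn u) cu); rewrite ltcR.
  rewrite (le_trans (uf _ _))// ler_wpM2r// lecR ltW//.
  by near: n; exact: inv_small.
exists (limn u) => x; apply/eqP; rewrite eq_sym -subr_eq0 -normr_le0.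
apply/ler_addgt0Pr => _ /posC[r r0 ->]; rewrite add0r.
have x1 : 0 < `|x| + 1 by rewrite ltr_wpDl.
have [s s0 xs] := posC _ x1.
have rs0 : 0 < r / 2 / s by rewrite !divr_gt0.
rewrite (le_trans (bnd _ _ rs0))//.
rewrite (@le_trans _ _ ((r / 2 / s * 2)%:C * s%:C))//.
  by rewrite ler_wpM2l -?xs ?lerDl// lecR mulr_ge0// ltW.
rewrite -rmorphM lecR le_eqVlt; apply/orP; left; apply/eqP; field.
by rewrite gt_eqF.
Unshelve. all: by end_near. Qed.
End riesz.

Fact adjoint_exists T : exists S : 'B(H), forall x y, '[T x, y] = '[x, S y].
Proof.
have rep y : exists z, forall x, '[T x, y] = '[x, z].
  apply: (@riesz_representation (fun x => '[T x, y]) _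
    (complex.Re (`|T| * `|y|))).
  - by move=> a u v /=; rewrite linearP linearPl.
  - move=> x; rewrite RRe_real ?ger0_real ?mulr_ge0//.
    rewrite (le_trans (inner_CauchySchwarz _ _))// mulrAC ler_wpM2r//.
    exact: opNorm_ge.
have [S TS] := choice rep.
have lS : linear S.
  move=> a u v; apply: inner_extl => z.
  by rewrite -TS !linearPr/= !TS.
have bS : S \in @bounded_linear R H.
  apply/asboolP; split=> //; exists `|T| => y.
  have [->|Sy0] := eqVneq (S y) 0; first by rewrite normr0 mulr_ge0.
  have nS0 : 0 < `|S y| by rewrite normr_gt0.
  rewrite -(ler_pM2r nS0) -expr2 -inner_normE -TS.
  rewrite -[leLHS]ger0_norm; last by rewrite TS dnorm_ge0.
  rewrite (le_trans (inner_CauchySchwarz _ _))// mulrAC ler_wpM2r//.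
  exact: opNorm_ge.
by exists (BoundedOp bS).
Qed.

Definition adjoint T : 'B(H) := sval (cid (adjoint_exists T)).

Lemma adjointP T x y : '[T x, y] = '[x, adjoint T y].
Proof. by rewrite /adjoint; case: cid. Qed.

End adjoint.

Section spectrum.
Context (R : realType) (H : hilbertType R).
Implicit Types (T : 'B(H)).

Definition spectrum T : set R[i] :=
  [set l | ~ exists S : 'B(H),
       cancel (T - l *: idOp H) S /\ cancel S (T - l *: idOp H)].

Definition point_spectrum T : set R[i] :=
  [set l | exists2 x : H, x != 0 & (T - l *: idOp H) x = 0].

Definition continuous_spectrum T : set R[i] :=
  spectrum T `\` (point_spectrum T `|`
                  [set (mu^*)%R | mu in point_spectrum (adjoint T)]).

End spectrum.

(* Main.v *)
Require Import Defs.
From HB Require Import structures.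
From mathcomp Require Import all_boot all_order all_algebra.
From mathcomp Require Import sesquilinear.
From mathcomp Require Import complex.
From mathcomp Require Import all_classical all_reals all_analysis.
From mathcomp Require Import borel_hierarchy.
From mathcomp Require Import zify ring lra.

From Corelib Require Setoid Morphisms RelationClasses.

(** Call an operator Weyl when it differs from an invertible operator by a
finite rank one, and let W(T) be the set of the z such that T - z is not Weyl.
It is a compact part of the spectrum of T, it depends only on the class of T
modulo the closure of the finite rank operators (the seminorm [essnorm] is the
norm of that quotient), and it is nonempty in infinite dimension
([ess_spectrum_nonempty]).  The point of continuous spectrum of a generic T is
found among the points of W(T) of largest real part ([top_weyl]): such a point l
is always spectral, so it only remains that T - l and its adjoint have dense
ranges, for each of them is then injective because the other has dense range
([top_continuous_spectrum]).

Having dense range is the conjunction, over the vectors a of a countable dense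
set and the integers n, of the open conditions that the range meets the ball of
center a and radius 1/(n+1) ([nearly_hits]).  For fixed a and n, let the operator
T be good when every operator near T satisfies this condition, and its analogue
for the adjoint, at all the top points of its Weyl spectrum ([stably_hits]).
Good operators form an open set by construction, and Baire's theorem reduces
everything to the density of this open set ([stably_hits_dense]).

For the density, let l be a top point of W(T) and eps > 0 be small.  As T - l is
not Weyl but T - l - t is Weyl for t > 0, the operator T - l has approximate
kernel vectors orthogonal to any prescribed finite family ([approx_kernel]).
They provide an orthonormal sequence whose images under T - l are as small and
as summable as desired; after a small perturbation, which does not affect W(T),
the operator T is the scalar l on the closed span M of this sequence.  Adding
eps S to it, where S is on M the adjoint of a unilateral shift of infinite
multiplicity, gives an operator T1 such that, for z of positive real part,
T1 - l - z is Z (1 - (eps / z) S) modulo finite rank, with Z invertible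
([push_eqfin]).  Hence, to the right of l, the set W(T1) is the part of the disc
of center l and radius eps, and its only top point is l + eps.  This point is
stable.  Inside the disc T1 - z is right invertible modulo finite rank with an
infinite dimensional kernel, so that no operator near T1 - z is Weyl
([not_weyl_near]); outside the disc Weyl operators remain Weyl.  So the top points
of the operators near T1 are near l + eps ([top_weyl_stable]).  Finally T can be
moved beforehand by a small finite rank operator in order to make T - l - eps
invertible ([weyl_approx_unit]); then T1 - l - eps is exactly Z (1 - S) for an
invertible Z ([push_factor]).  Its range is dense, and so is that of its adjoint,
because 1 - S and 1 - S^* have dense ranges ([dense_range_1S],
[dense_range_1X]). *)

Set Implicit Arguments.
Unset Strict Implicit.
Unset Printing Implicit Defensive.

Import Order.TTheory GRing.Theory Num.Theory Num.Def.
Import numFieldNormedType.Exports.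

Local Open Scope classical_set_scope.
Local Open Scope complex_scope.
Local Open Scope ring_scope.

(** * The real-valued norm and the ring of bounded operators *)

(** Norms of normed modules over R[i] are complex numbers; estimates are carried
out on this real-valued version, which is locked so that arithmetic tactics treat
it as an atom. *)
HB.lock Definition nrm (R : realType) (U : normedZmodType R[i]) (x : U) : R :=
  complex.Re `|x|.
Arguments nrm {R U} x.

Section real_norm.
Context {R : realType}.

Section zmod.
Context (U : normedZmodType R[i]).
Implicit Types x y z : U.

Lemma nrmE x : `|x| = (nrm x)%:C.
Proof. by rewrite nrm.unlock RRe_real// ger0_real. Qed.

Lemma nrm_ge0 x : 0 <= nrm x.
Proof. by have := normr_ge0 x; rewrite nrmE lecR. Qed.

Lemma nrm0 : nrm (0 : U) = 0.
Proof. by rewrite nrm.unlock normr0. Qed.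

Lemma nrm0_eq0 x : nrm x = 0 -> x = 0.
Proof. by move=> x0; apply/normr0_eq0; rewrite nrmE x0. Qed.

Lemma nrm_gt0 x : x != 0 -> 0 < nrm x.
Proof. by rewrite -ltcR -nrmE normr_gt0. Qed.

Lemma nrmD x y : nrm (x + y) <= nrm x + nrm y.
Proof. by rewrite -lecR rmorphD/= -!nrmE ler_normD. Qed.

Lemma nrmN x : nrm (- x) = nrm x.
Proof. by rewrite nrm.unlock normrN. Qed.

Lemma nrmB x y : nrm (x - y) <= nrm x + nrm y.
Proof. by rewrite -(nrmN y) nrmD. Qed.

Lemma nrmC x y : nrm (x - y) = nrm (y - x).
Proof. by rewrite -nrmN opprB. Qed.

Lemma nrm_tri y x z : nrm (x - z) <= nrm (x - y) + nrm (y - z).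
Proof. by rewrite -[x - z](subrKA y) nrmD. Qed.

Lemma nrm_sum I (r : seq I) (F : I -> U) :
  nrm (\sum_(i <- r) F i) <= \sum_(i <- r) nrm (F i).
Proof.
elim: r => [|i r IH]; first by rewrite !big_nil nrm0.
by rewrite !big_cons (le_trans (nrmD _ _))// lerD.
Qed.

End zmod.

Lemma nrmZ (U : normedModType R[i]) (a : R[i]) (x : U) :
  nrm (a *: x) = nrm a * nrm x.
Proof.
by apply: complexI; rewrite rmorphM/= -!nrmE normrZ.
Qed.

Lemma nrmM (a b : R[i]) : nrm (a * b) = nrm a * nrm b.
Proof. by apply: complexI; rewrite rmorphM/= -!nrmE normrM. Qed.

Lemma nrmR (r : R) : nrm (r%:C : R[i]) = `|r|.
Proof. by rewrite nrm.unlock normc_def/= expr0n addr0 sqrtr_sqr. Qed.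

Lemma nrmV (a : R[i]) : nrm (a^-1) = (nrm a)^-1.
Proof. by apply: complexI; rewrite fmorphV/= -!nrmE normfV. Qed.

Lemma nrmX (a : R[i]) n : nrm (a ^+ n) = nrm a ^+ n.
Proof. by apply: complexI; rewrite rmorphXn/= -!nrmE normrX. Qed.

Lemma Re_le_nrm (a : R[i]) : complex.Re a <= nrm a.
Proof. by rewrite (le_trans (ler_norm _))// -lecR -nrmE normc_ge_Re. Qed.

Definition seq_to (U : normedZmodType R[i]) (u : nat -> U) (l : U) :=
  forall e : R, 0 < e -> exists N, forall n, (N <= n)%N -> nrm (l - u n) < e.

Definition seq_complete (U : normedZmodType R[i]) := forall u : nat -> U,
  (forall e : R, 0 < e -> exists N, forall m n, (N <= m)%N -> (N <= n)%N ->
     nrm (u m - u n) < e) ->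
  exists l, seq_to u l.

Lemma nrm_complete (U : completeNormedModType R[i]) : seq_complete U.
Proof.
have posC (e : R[i]) : 0 < e -> exists2 r : R, 0 < r & e = r%:C.
  move=> e0; exists (complex.Re e); last by rewrite RRe_real// gtr0_real.
  by move: e0; rewrite ltcE => /andP[].
move=> u uC.
have cu : cvgn u.
  apply: cauchy_cvg; apply/cauchy_exP => _ /posC[r r0 ->].
  have [N Nr] := uC _ r0.
  exists (u N); exists N => //= n Nn.
  by rewrite -ball_normE/= nrmE ltcR Nr.
exists (limn u) => e e0.
have e0C : 0 < e%:C :> R[i] by rewrite ltcR.
have [N _ NH] := @cvgr_dist_lt _ _ _ \oo _ u (limn u) cu _ e0C.
by exists N => n /NH/=; rewrite nrmE ltcR.
Qed.

End real_norm.

Section operator_ring.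
Context (R : realType) (V : normedModType R[i]).
Implicit Types S T : 'B(V).

Fact opcomp_subproof S T : (S \o T) \in @bounded_linear R V.
Proof.
apply/asboolP; split; first by move=> a u v /=; rewrite !linearP.
exists (`|S| * `|T|) => x /=.
rewrite (le_trans (opNorm_ge S _))// -mulrA; apply: ler_wpM2l.
  exact: (normr_ge0 S).
exact: opNorm_ge.
Qed.

Definition opcomp S T : 'B(V) := BoundedOp (opcomp_subproof S T).

Fact opcompA : associative opcomp.
Proof. by move=> A B C; exact: boundedOpP. Qed.

Fact opcomp1l : left_id (idOp V) opcomp.
Proof. by move=> A; exact: boundedOpP. Qed.

Fact opcomp1r : right_id (idOp V) opcomp.
Proof. by move=> A; exact: boundedOpP. Qed.

Fact opcompDl : left_distributive opcomp +%R.
Proof. by move=> A B C; exact: boundedOpP. Qed.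

Fact opcompDr : right_distributive opcomp +%R.
Proof. by move=> A B C; apply: boundedOpP => x /=; rewrite linearD. Qed.

HB.instance Definition _ := GRing.Zmodule_isPzRing.Build 'B(V)
  opcompA opcomp1l opcomp1r opcompDl opcompDr.

Lemma op1E x : (1 : 'B(V)) x = x. Proof. by []. Qed.
Lemma opME S T x : (S * T) x = S (T x). Proof. by []. Qed.

Lemma opZl a S T : (a *: S) * T = a *: (S * T).
Proof. exact: boundedOpP. Qed.

Lemma opZr a S T : S * (a *: T) = a *: (S * T).
Proof. by apply: boundedOpP => x; rewrite opME !boundedOpZ linearZ. Qed.

Lemma nrm_op T x : nrm (T x) <= nrm T * nrm x.
Proof. by rewrite -lecR rmorphM/= -!nrmE; exact: opNorm_ge. Qed.

Lemma nrm_op_le T (M : R) : 0 <= M ->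
  (forall x, nrm (T x) <= M * nrm x) -> nrm T <= M.
Proof.
move=> M0 TM; rewrite nrm.unlock; apply: opNorm_le => // x.
by rewrite !nrmE -rmorphM lecR.
Qed.

Lemma nrm_mul S T : nrm (S * T) <= nrm S * nrm T.
Proof.
apply: nrm_op_le; first by rewrite mulr_ge0// nrm_ge0.
move=> x; rewrite opME (le_trans (nrm_op _ _))// -mulrA ler_wpM2l ?nrm_ge0//.
exact: nrm_op.
Qed.

Lemma nrm_1 : nrm (1 : 'B(V)) <= 1.
Proof. by apply: nrm_op_le => // x; rewrite mul1r. Qed.

Lemma nrm_exp T n : nrm (T ^+ n) <= nrm T ^+ n.
Proof.
elim: n => [|n IH]; first exact: nrm_1.
by rewrite !exprS (le_trans (nrm_mul _ _))// ler_wpM2l ?nrm_ge0.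
Qed.

End operator_ring.

Lemma nrm_small0 (R : realType) (U : normedZmodType R[i]) (x : U) :
  (forall e : R, 0 < e -> nrm x <= e) -> x = 0.
Proof.
move=> xe; apply: nrm0_eq0; apply/eqP; rewrite eq_le nrm_ge0 andbT.
by apply/ler_addgt0Pr => e /xe; rewrite add0r.
Qed.

Lemma expr_small (R : realType) (q e : R) : 0 <= q < 1 -> 0 < e ->
  exists N, forall n, (N <= n)%N -> q ^+ n < e.
Proof.
move=> /andP[q0 q1] e0.
have q1' : `|q| < 1 by rewrite ger0_norm.
have [N _ NH] := @cvgr_dist_lt _ _ _ \oo _ _ _ (cvg_expr q1') _ e0.
by exists N => n /NH/=; rewrite sub0r normrN ger0_norm ?exprn_ge0.
Qed.

Section completeness.
Context {R : realType}.

Lemma geometric_cvg (U : normedZmodType R[i]) (u : nat -> U) (C q : R) :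
  seq_complete U -> 0 <= q < 1 -> 0 <= C ->
  (forall n, nrm (u n.+1 - u n) <= C * q ^+ n) ->
  exists l, seq_to u l.
Proof.
move=> cU /[dup] q01 /andP[q0 q1] C0 uC; apply: cU => e e0.
have p1 : 0 < 1 - q by rewrite subr_gt0.
have dist n k : nrm (u (n + k)%N - u n) <= C / (1 - q) * q ^+ n * (1 - q ^+ k).
  elim: k => [|k IH]; first by rewrite addn0 subrr nrm0 expr0 subrr mulr0.
  rewrite (le_trans (nrm_tri (u (n + k)%N) _ _))// addnS.
  rewrite (le_trans (lerD (uC _) IH))// exprD exprS le_eqVlt; apply/orP; left.
  by apply/eqP; field; rewrite gt_eqF.
have dist' n m : (n <= m)%N -> nrm (u m - u n) <= C / (1 - q) * q ^+ n.
  move=> /subnKC <-; rewrite (le_trans (dist _ _))// ler_piMr//.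
    by rewrite !mulr_ge0 ?exprn_ge0// invr_ge0 ltW.
  by rewrite gerBl exprn_ge0.
have d0 : 0 < e / (C / (1 - q) + 1).
  by rewrite divr_gt0// ltr_wpDl// divr_ge0// ltW.
have [N NH] := expr_small q01 d0.
have small n : (N <= n)%N -> C / (1 - q) * q ^+ n < e.
  move=> /NH; rewrite ltr_pdivlMr; last by rewrite ltr_wpDl// divr_ge0// ltW.
  apply: le_lt_trans; rewrite mulrC ler_wpM2l ?exprn_ge0//.
  by rewrite lerDl.
exists N => m n Nm Nn.
have [mn|/ltnW nm] := leqP m n.
  by rewrite nrmC (le_lt_trans (dist' _ _ mn))// small.
by rewrite (le_lt_trans (dist' _ _ nm))// small.
Qed.

(** A Cauchy sequence of operators converges pointwise; the pointwise limit
inherits linearity, and its boundedness and the convergence in norm come from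
the uniformity of the Cauchy condition. *)
Lemma op_complete (V : completeNormedModType R[i]) : seq_complete 'B(V).
Proof.
move=> u uC.
have ptC x : forall e : R, 0 < e -> exists N, forall m n,
    (N <= m)%N -> (N <= n)%N -> nrm (u m x - u n x) < e.
  move=> e e0; have x1 : 0 < nrm x + 1 by rewrite ltr_wpDl ?nrm_ge0.
  have [N NH] := uC _ (divr_gt0 e0 x1).
  exists N => m n Nm Nn; rewrite -boundedOpB (le_lt_trans (nrm_op _ _))//.
  have := NH _ _ Nm Nn; rewrite ltr_pdivlMr// => /(le_lt_trans _); apply.
  by rewrite ler_wpM2l ?nrm_ge0// lerDl.
have [L HL] := choice (fun x => nrm_complete (ptC x)).
have HL2 x y a e : 0 < e -> exists n, [/\ nrm (L x - u n x) < e,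
    nrm (L y - u n y) < e & nrm (L (a *: x + y) - u n (a *: x + y)) < e].
  move=> e0; have [N1 H1] := HL x _ e0; have [N2 H2] := HL y _ e0.
  have [N3 H3] := HL (a *: x + y) _ e0.
  exists (maxn N1 (maxn N2 N3)); split; [apply: H1|apply: H2|apply: H3];
    by rewrite !leq_max leqnn ?orbT.
have linL : linear L.
  move=> a x y; apply/eqP; rewrite -subr_eq0; apply/eqP.
  apply: nrm_small0 => e e0.
  have d0 : 0 < e / (nrm a + 2).
    by rewrite divr_gt0// ltr_wpDl ?nrm_ge0.
  have [n [nx ny nxy]] := HL2 x y a _ d0.
  rewrite (_ : _ - _ = (L (a *: x + y) - u n (a *: x + y))
     - (a *: (L x - u n x) + (L y - u n y))); last first.
    have -> : a *: (L x - u n x) + (L y - u n y) =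
        (a *: L x + L y) - u n (a *: x + y).
      by rewrite linearP scalerBr addrACA opprD.
    by rewrite opprB subrKA.
  rewrite (le_trans (nrmB _ _))//.
  rewrite (@le_trans _ _ (e / (nrm a + 2) + (nrm a * (e / (nrm a + 2))
    + e / (nrm a + 2))))//.
    apply: lerD; first exact: ltW.
    rewrite (le_trans (nrmD _ _))// nrmZ lerD ?(ltW ny)//.
    by rewrite ler_wpM2l ?nrm_ge0// ltW.
  rewrite le_eqVlt; apply/orP; left; apply/eqP; field.
  by rewrite gt_eqF// ltr_wpDl ?nrm_ge0.
have unif e : 0 < e -> exists N, forall n, (N <= n)%N ->
    forall x, nrm (L x - u n x) <= e * nrm x.
  move=> e0; have [N NH] := uC _ e0; exists N => n Nn x.
  apply/ler_addgt0Pr => d d0.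
  have [M MH] := HL x _ d0.
  rewrite (le_trans (nrm_tri (u (maxn M N) x) _ _))// addrC lerD//.
    rewrite -boundedOpB (le_trans (nrm_op _ _))// ler_wpM2r ?nrm_ge0// ltW//.
    by apply: NH => //; rewrite leq_maxr.
  by rewrite ltW// MH// leq_maxl.
have bL : L \in @bounded_linear R V.
  apply/asboolP; split=> //.
  have [N NH] := unif _ ltr01; exists (1 + nrm (u N))%:C => x.
  rewrite !nrmE -rmorphM lecR mulrDl -[L x](subrK (u N x)).
  by rewrite (le_trans (nrmD _ _))// lerD ?NH ?nrm_op.
exists (BoundedOp bL) => e e0.
have e20 : 0 < e / 2 by rewrite divr_gt0.
have [N NH] := unif _ e20; exists N => n Nn.
rewrite (@le_lt_trans _ _ (e / 2))//; last by lra.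
by apply: nrm_op_le; [exact: ltW|move=> x; exact: NH].
Qed.

End completeness.

Section invertible.
Context {R : realType} {V : completeNormedModType R[i]}.
Implicit Types A B S T : 'B(V).

Definition op_unit T := exists S : 'B(V), T * S = 1 /\ S * T = 1.

Lemma op_unitM S T : op_unit S -> op_unit T -> op_unit (S * T).
Proof.
move=> [S' [SS' S'S]] [T' [TT' T'T]]; exists (T' * S'); split.
  by rewrite mulrA -(mulrA S) TT' mulr1.
by rewrite mulrA -(mulrA T') S'S mulr1.
Qed.

Lemma op_unitZ a T : a != 0 -> op_unit T -> op_unit (a *: T).
Proof.
move=> a0 [S [TS ST]]; exists (a^-1 *: S).
by rewrite !opZl !opZr !scalerA mulfV// mulVf// TS ST !scale1r.
Qed.

(** The inverse is the sum of the powers of A. *)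
Lemma neumann A : nrm A < 1 -> op_unit (1 - A).
Proof.
move=> A1; pose s n := \sum_(i < n) A ^+ i.
have q01 : 0 <= nrm A < 1 by rewrite nrm_ge0.
have [] := @geometric_cvg _ _ s 1 (nrm A) (@op_complete _ V) q01 ler01.
  move=> n; rewrite /s big_ord_recr/= addrAC subrr add0r mul1r.
  exact: nrm_exp.
move=> B BH; exists B.
have tele n : (1 - A) * s n = 1 - A ^+ n.
  elim: n => [|n IH]; first by rewrite /s big_ord0 mulr0 expr0 subrr.
  by rewrite /s big_ord_recr/= mulrDr IH mulrBl mul1r exprS subrKA.
have tele' n : s n * (1 - A) = 1 - A ^+ n.
  elim: n => [|n IH]; first by rewrite /s big_ord0 mul0r expr0 subrr.
  by rewrite /s big_ord_recr/= mulrDl IH mulrBr mulr1 exprSr subrKA.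
have close e : 0 < e -> exists n, nrm (1 - A) * nrm (B - s n) + nrm (A ^+ n) <= e.
  move=> e0; have d0 : 0 < e / 2 / (nrm (1 - A) + 1).
    by rewrite !divr_gt0// ltr_wpDl ?nrm_ge0.
  have e20 : 0 < e / 2 by rewrite divr_gt0.
  have [N NH] := BH _ d0; have [M MH] := expr_small q01 e20.
  exists (maxn N M); have := NH _ (leq_maxl N M).
  rewrite ltr_pdivlMr ?ltr_wpDl ?nrm_ge0// => Bs.
  have AM := le_lt_trans (nrm_exp A _) (MH _ (leq_maxr N M)).
  rewrite [e]splitr lerD//; last exact: ltW.
  rewrite (le_trans _ (ltW Bs))// mulrC ler_wpM2l ?nrm_ge0//.
  by rewrite lerDl.
split; apply/eqP; rewrite -subr_eq0; apply/eqP; apply: nrm_small0 => e /close[n ne].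
  rewrite (_ : _ - 1 = (1 - A) * (B - s n) - A ^+ n).
    by rewrite (le_trans (nrmB _ _))// (le_trans _ ne)// lerD2r nrm_mul.
  by rewrite mulrBr tele opprB addrA addrAC addrK.
rewrite (_ : _ - 1 = (B - s n) * (1 - A) - A ^+ n).
  rewrite (le_trans (nrmB _ _))// (le_trans _ ne)// lerD2r.
  by rewrite (le_trans (nrm_mul _ _))// mulrC.
by rewrite mulrBl tele' opprB addrA addrAC addrK.
Qed.

Lemma op_unit_near T : op_unit T ->
  exists2 d : R, 0 < d & forall E, nrm E < d -> op_unit (T + E).
Proof.
move=> [S [TS ST]]; exists (nrm S + 1)^-1.
  by rewrite invr_gt0 ltr_wpDl ?nrm_ge0.
move=> E Ed.
have -> : T + E = T * (1 - (- (S * E))).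
  by rewrite opprK mulrDr mulr1 mulrA TS mul1r.
apply: op_unitM; first by exists S.
apply: neumann; rewrite nrmN (le_lt_trans (nrm_mul _ _))//.
have S1 : 0 < nrm S + 1 by rewrite ltr_wpDl ?nrm_ge0.
have : nrm E * (nrm S + 1) < 1 by rewrite -ltr_pdivlMr// div1r.
by apply: le_lt_trans; rewrite mulrC ler_wpM2l ?nrm_ge0// lerDl.
Qed.

End invertible.

(** * Finite rank operators, the essential norm and Weyl operators *)

Notation "z %:op" := (z *: (1 : boundedOp _))
  (at level 2, format "z %:op") : ring_scope.

Section hilbert.
Context {R : realType} {H : hilbertType R}.
Implicit Types (x y z u v : H) (S T : 'B(H)).
Local Notation "''[' x , y ]" := (inner x y) : ring_scope.

Lemma inner_nrm x : '[x, x] = (nrm x ^+ 2)%:C.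
Proof. by rewrite inner_normE nrmE rmorphXn. Qed.

Lemma nrm_inner x y : nrm '[x, y] <= nrm x * nrm y.
Proof. by rewrite -lecR rmorphM/= -!nrmE; exact: inner_CauchySchwarz. Qed.

Lemma nrm_inner_unit x y : nrm x = 1 -> nrm '[y, x] <= nrm y.
Proof. by move=> x1; have := nrm_inner y x; rewrite x1 mulr1. Qed.

Lemma inner0C x y : '[x, y] = 0 -> '[y, x] = 0.
Proof. by move=> xy; rewrite innerC xy conjC0. Qed.

Lemma innerDl x y z : '[x + y, z] = '[x, z] + '[y, z].
Proof. exact: linearDl. Qed.
Lemma innerDr x y z : '[z, x + y] = '[z, x] + '[z, y].
Proof. exact: linearDr. Qed.
Lemma innerBl x y z : '[x - y, z] = '[x, z] - '[y, z].
Proof. exact: linearBl. Qed.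
Lemma innerBr x y z : '[z, x - y] = '[z, x] - '[z, y].
Proof. exact: linearBr. Qed.
Lemma innerZl a x z : '[a *: x, z] = a * '[x, z].
Proof. exact: linearZl_LR. Qed.
Lemma innerZr a x z : '[z, a *: x] = a^* * '[z, x].
Proof. exact: linearZr_LR. Qed.
Lemma inner0l z : '[0, z] = 0. Proof. exact: linear0l. Qed.
Lemma inner0r z : '[z, 0] = 0. Proof. exact: linear0r. Qed.

Lemma pythagoras x y : '[x, y] = 0 -> nrm (x + y) ^+ 2 = nrm x ^+ 2 + nrm y ^+ 2.
Proof.
move=> xy; apply: complexI; rewrite rmorphD/= -!inner_nrm.
by rewrite innerDl !innerDr xy (inner0C xy) addr0 add0r.
Qed.

Lemma adjointE S T : (forall x y, '[S x, y] = '[x, T y]) -> adjoint S = T.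
Proof.
by move=> ST; apply: boundedOpP => y; apply: inner_extl => z;
  rewrite -adjointP ST.
Qed.

Lemma adjoint_inner T x y : '[adjoint T x, y] = '[x, T y].
Proof. by rewrite innerC -adjointP -innerC. Qed.

Lemma adjointK T : adjoint (adjoint T) = T.
Proof. by apply: adjointE => x y; rewrite adjoint_inner. Qed.

Lemma adjointM S T : adjoint (S * T) = adjoint T * adjoint S.
Proof. by apply: adjointE => x y; rewrite !opME !adjointP. Qed.

Lemma adjoint1 : adjoint (1 : 'B(H)) = 1.
Proof. exact: adjointE. Qed.

Lemma adjointB S T : adjoint (S - T) = adjoint S - adjoint T.
Proof.
by apply: adjointE => x y; rewrite !boundedOpB innerBl innerBr !adjointP.
Qed.

Lemma adjointZ a T : adjoint (a *: T) = a^* *: adjoint T.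
Proof.
by apply: adjointE => x y; rewrite !boundedOpZ innerZl innerZr conjCK adjointP.
Qed.

Lemma nrm_adjoint T : nrm (adjoint T) <= nrm T.
Proof.
apply: nrm_op_le; first exact: nrm_ge0.
move=> y; have [->|y0] := eqVneq (adjoint T y) 0.
  by rewrite nrm0 mulr_ge0 ?nrm_ge0.
rewrite -(ler_pM2r (nrm_gt0 y0)) -expr2 -lecR -inner_nrm -adjointP.
rewrite -[leLHS]RRe_real ?lecR; last first.
  by rewrite adjointP ger0_real// dnorm_ge0.
rewrite (le_trans (Re_le_nrm _))// (le_trans (nrm_inner _ _))//.
by rewrite mulrAC ler_wpM2r ?nrm_ge0// nrm_op.
Qed.

Lemma op_unit_adjoint T : op_unit T -> op_unit (adjoint T).
Proof.
by move=> [S [TS ST]]; exists (adjoint S); rewrite -!adjointM TS ST adjoint1.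
Qed.

Fact rank1_subproof u v : (fun x => '[x, u] *: v) \in @bounded_linear R H.
Proof.
apply/asboolP; split.
  by move=> a x y; rewrite innerDl innerZl scalerDl scalerA.
exists (nrm u * nrm v)%:C => x.
rewrite !nrmE -rmorphM lecR nrmZ mulrC (mulrC (nrm u)) -mulrA.
by rewrite ler_wpM2l ?nrm_ge0// mulrC nrm_inner.
Qed.

Definition rank1 u v : 'B(H) := BoundedOp (rank1_subproof u v).

Lemma rank1E u v x : rank1 u v x = '[x, u] *: v. Proof. by []. Qed.

Lemma mul_op_rank1 T u v : T * rank1 u v = rank1 u (T v).
Proof. by apply: boundedOpP => x; rewrite opME !rank1E linearZ. Qed.

Lemma mul_rank1_op T u v : rank1 u v * T = rank1 (adjoint T u) v.
Proof. by apply: boundedOpP => x; rewrite opME !rank1E adjointP. Qed.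

Lemma scale_rank1 a u v : a *: rank1 u v = rank1 u (a *: v).
Proof. by apply: boundedOpP => x; rewrite boundedOpZ !rank1E !scalerA mulrC. Qed.

(** Finite rank operators are presented as finite sums of rank one operators,
which makes them visibly a two-sided ideal. *)
Definition finrank T := exists s : seq (H * H), T = \sum_(p <- s) rank1 p.1 p.2.

Lemma finrank0 : finrank 0.
Proof. by exists [::]; rewrite big_nil. Qed.

Lemma finrank_rank1 u v : finrank (rank1 u v).
Proof. by exists [:: (u, v)]; rewrite big_seq1. Qed.

Lemma finrankD S T : finrank S -> finrank T -> finrank (S + T).
Proof. by move=> [s ->] [t ->]; exists (s ++ t); rewrite big_cat. Qed.

Lemma finrankZ a T : finrank T -> finrank (a *: T).
Proof.
move=> [s ->]; exists [seq (p.1, a *: p.2) | p <- s].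
by rewrite big_map scaler_sumr; apply: eq_bigr => p _; rewrite scale_rank1.
Qed.

Lemma finrankN T : finrank T -> finrank (- T).
Proof. by rewrite -scaleN1r; exact: finrankZ. Qed.

Lemma finrankMl S T : finrank T -> finrank (S * T).
Proof.
move=> [s ->]; exists [seq (p.1, S p.2) | p <- s].
by rewrite big_map mulr_sumr; apply: eq_bigr => p _; rewrite mul_op_rank1.
Qed.

Lemma finrankMr S T : finrank T -> finrank (T * S).
Proof.
move=> [s ->]; exists [seq (adjoint S p.1, p.2) | p <- s].
by rewrite big_map mulr_suml; apply: eq_bigr => p _; rewrite mul_rank1_op.
Qed.

(** Congruence modulo finite rank operators; the instances below allow rewriting
with it under the operations of the algebra. *)
Definition eqfin S T := finrank (S - T).

Global Instance eqfin_equiv : RelationClasses.Equivalence eqfin.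
Proof.
split.
- by move=> S; rewrite /eqfin subrr; exact: finrank0.
- by move=> S T /finrankN; rewrite opprB.
- by move=> S T U ST /(finrankD ST); rewrite subrKA.
Qed.

Global Instance eqfinD : Morphisms.Proper
  (Morphisms.respectful eqfin (Morphisms.respectful eqfin eqfin)) +%R.
Proof.
by move=> S S' SS T T' TT; rewrite /eqfin opprD addrACA; exact: finrankD.
Qed.

Global Instance eqfinN : Morphisms.Proper (Morphisms.respectful eqfin eqfin) -%R.
Proof. by move=> S S' /finrankN; rewrite /eqfin opprD. Qed.

Global Instance eqfinM : Morphisms.Proper
  (Morphisms.respectful eqfin (Morphisms.respectful eqfin eqfin)) *%R.
Proof.
move=> S S' SS T T' TT; rewrite /eqfin.
have -> : S * T - S' * T' = (S - S') * T + S' * (T - T').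
  by rewrite mulrBl mulrBr subrKA.
by apply: finrankD; [exact: finrankMr|exact: finrankMl].
Qed.

Global Instance eqfinZ a :
  Morphisms.Proper (Morphisms.respectful eqfin eqfin) ( *:%R a).
Proof. by move=> S S' SS; rewrite /eqfin -scalerBr; exact: finrankZ. Qed.

Lemma eqfin_add S F : finrank F -> eqfin (S + F) S.
Proof. by rewrite /eqfin addrAC subrr add0r. Qed.

Lemma eqfinP S T : eqfin S T -> exists2 F, finrank F & S = T + F.
Proof. by exists (S - T); rewrite // addrC subrK. Qed.

Lemma eqfin_refl S : eqfin S S. Proof. by reflexivity. Qed.
#[local] Hint Resolve eqfin_refl : core.

(** This is the quotient seminorm modulo finite rank operators, that is, the norm
in the quotient by their closure. *)
Definition essnorm S : R := inf [set nrm (S + F) | F in finrank].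

Lemma essnorm_le S F : finrank F -> essnorm S <= nrm (S + F).
Proof.
move=> fF; apply: ge_inf; last by exists F.
by exists 0 => _ [G _ <-]; exact: nrm_ge0.
Qed.

Lemma essnorm_ge S c : (forall F, finrank F -> c <= nrm (S + F)) -> c <= essnorm S.
Proof.
move=> cS; apply: lb_le_inf; first by exists (nrm (S + 0)), 0 => //; exact: finrank0.
by move=> _ [F fF <-]; exact: cS.
Qed.

Lemma essnorm_adh S e : 0 < e ->
  exists T, eqfin T S /\ nrm T < essnorm S + e.
Proof.
move=> e0; have iS : has_inf [set nrm (S + F) | F in finrank].
  split; first by exists (nrm (S + 0)), 0 => //; exact: finrank0.
  by exists 0 => _ [G _ <-]; exact: nrm_ge0.
have [_ [F fF <-] SF] := inf_adherent e0 iS.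
by exists (S + F); split=> //; exact: eqfin_add.
Qed.

Lemma essnorm_le_nrm S : essnorm S <= nrm S.
Proof. by have := essnorm_le S finrank0; rewrite addr0. Qed.

Lemma essnorm_ge0 S : 0 <= essnorm S.
Proof. by apply: essnorm_ge => F _; exact: nrm_ge0. Qed.

Lemma essnorm_eqfin_le S T : eqfin T S -> essnorm S <= nrm T.
Proof. by move=> TS; have := essnorm_le S TS; rewrite addrC subrK. Qed.

Lemma eqfin_essnorm S T : eqfin S T -> essnorm S = essnorm T.
Proof.
suff le S' T' : eqfin S' T' -> essnorm T' <= essnorm S'.
  by move=> ST; apply/eqP; rewrite eq_le !le//; symmetry.
move=> ST; apply: essnorm_ge => F fF; apply: essnorm_eqfin_le.
by rewrite eqfin_add.
Qed.

Global Instance essnorm_proper :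
  Morphisms.Proper (Morphisms.respectful eqfin eq) essnorm.
Proof. exact: eqfin_essnorm. Qed.

Lemma essnormD S T : essnorm (S + T) <= essnorm S + essnorm T.
Proof.
apply/ler_addgt0Pr => e e0; have e20 : 0 < e / 2 by rewrite divr_gt0.
have [S' [SS S'e]] := essnorm_adh S e20.
have [T' [TT T'e]] := essnorm_adh T e20.
have : essnorm (S + T) <= nrm (S' + T').
  by apply: essnorm_eqfin_le; rewrite SS TT.
by have := nrmD S' T'; lra.
Qed.

Lemma essnormM S T : essnorm (S * T) <= essnorm S * essnorm T.
Proof.
apply/ler_addgt0Pr => e e0.
pose s := essnorm S; pose t := essnorm T.
have s0 : 0 <= s := essnorm_ge0 S; have t0 : 0 <= t := essnorm_ge0 T.
pose d := minr 1 (e / (s + t + 1)).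
have d0 : 0 < d by rewrite lt_min ltr01 divr_gt0//; lra.
have d1 : d <= 1 by rewrite ge_min lexx.
have de : d * (s + t + 1) <= e.
  by rewrite -ler_pdivlMr ?ge_min ?lexx ?orbT//; lra.
have [S' [SS S'e]] := essnorm_adh S d0.
have [T' [TT T'e]] := essnorm_adh T d0.
have : essnorm (S * T) <= nrm (S' * T').
  by apply: essnorm_eqfin_le; rewrite SS TT.
move/le_trans; apply; rewrite (le_trans (nrm_mul _ _))//.
have := ler_pM (nrm_ge0 _) (nrm_ge0 _) (ltW S'e) (ltW T'e).
move/le_trans; apply; rewrite -/s -/t; nra.
Qed.

Lemma essnormZ a S : essnorm (a *: S) <= nrm a * essnorm S.
Proof.
apply/ler_addgt0Pr => e e0.
have d0 : 0 < e / (nrm a + 1) by rewrite divr_gt0// ltr_wpDl ?nrm_ge0.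
have [S' [SS S'e]] := essnorm_adh S d0.
have : essnorm (a *: S) <= nrm (a *: S').
  by apply: essnorm_eqfin_le; rewrite SS.
rewrite nrmZ => /le_trans; apply.
rewrite (le_trans (ler_wpM2l (nrm_ge0 _) (ltW S'e)))// mulrDr lerD2l.
rewrite mulrCA -[leRHS]mulr1 ler_wpM2l ?(ltW e0)// ler_pdivrMr ?mul1r ?lerDl//.
by rewrite ltr_wpDl ?nrm_ge0.
Qed.

Lemma essnormN S : essnorm (- S) <= essnorm S.
Proof. by have := essnormZ (-1) S; rewrite scaleN1r nrmN nrm.unlock normr1/= mul1r. Qed.

Lemma essnormB S T : essnorm (S - T) <= essnorm S + essnorm T.
Proof. by rewrite (le_trans (essnormD _ _))// lerD2l essnormN. Qed.

(** These are the Fredholm operators of index 0.  In this form, their invariance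
under finite rank perturbations is immediate and no index is involved. *)
Definition weyl T := exists2 Z, op_unit Z & eqfin T Z.

Global Instance weyl_proper :
  Morphisms.Proper (Morphisms.respectful eqfin iff) weyl.
Proof.
by move=> S T ST; split=> -[Z uZ]; [rewrite ST|rewrite -ST]; exists Z.
Qed.

Lemma op_unit_weyl T : op_unit T -> weyl T.
Proof. by move=> uT; exists T. Qed.

Lemma weylM S T : weyl S -> weyl T -> weyl (S * T).
Proof.
move=> [Y uY SY] [Z uZ TZ]; exists (Y * Z); first exact: op_unitM.
by rewrite SY TZ.
Qed.

(** A representative of A modulo finite rank has norm less than 1, and the
Neumann series applies to it. *)
Lemma weyl_neumann A : essnorm A < 1 -> weyl (1 + A).
Proof.
move=> A1; have e0 : 0 < 1 - essnorm A by rewrite subr_gt0.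
have [B [BA B1]] := essnorm_adh A e0.
rewrite -BA -[B]opprK; apply/op_unit_weyl/neumann.
by rewrite nrmN; move: B1; rewrite addrC subrK.
Qed.

Lemma weyl_near T : weyl T ->
  exists2 d : R, 0 < d & forall E, essnorm E < d -> weyl (T + E).
Proof.
move=> [Z [Y [ZY YZ]] TZ].
have Y1 : 0 < essnorm Y + 1 by rewrite ltr_wpDl ?essnorm_ge0.
exists (essnorm Y + 1)^-1; first by rewrite invr_gt0.
move=> E Ed; rewrite TZ (_ : Z + E = Z * (1 + Y * E)); last first.
  by rewrite mulrDr mulr1 mulrA ZY mul1r.
apply: weylM; first by apply: op_unit_weyl; exists Y.
apply: weyl_neumann; rewrite (le_lt_trans (essnormM _ _))//.
have : essnorm E * (essnorm Y + 1) < 1 by rewrite -ltr_pdivlMr// div1r.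
by apply: le_lt_trans; rewrite mulrC ler_wpM2l ?essnorm_ge0// lerDl.
Qed.

End hilbert.

#[local] Hint Resolve eqfin_refl : core.

(** * The Weyl spectrum is nonempty *)

Lemma nrm_Re_Im (R : realType) (z : R[i]) :
  nrm z <= `|complex.Re z| + `|complex.Im z|.
Proof.
rewrite [in leLHS](complexE z) (le_trans (nrmD _ _))// nrmR lerD2l.
by rewrite nrmM nrmR nrm.unlock normc_def/= expr0n/= add0r expr1n sqrtr1 mul1r.
Qed.

(** Compactness of the closed disc of radius B, in the form of a passage from
local to uniform bounds. *)
Lemma disc_uniform (R : realType) (B : R) (P : R[i] -> R -> Prop) :
  (forall z, nrm z <= B ->
     exists2 r : R, 0 < r & exists c, forall w, nrm (w - z) < r -> P w c) ->
  (forall w c c', c <= c' -> P w c -> P w c') ->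
  exists c, forall w, nrm w <= B -> P w c.
Proof.
move=> locP monP; pose toC (p : R * R) : R[i] := Complex p.1 p.2.
have : compact (`[- B, B]%classic `*` `[- B, B]%classic : set (R * R)).
  by apply: compact_setX; exact: segment_compact.
rewrite compact_near_coveringP.
move=> /(_ R (pinfty_nbhs R) (fun c p => nrm (toC p) <= B -> P (toC p) c) _)[].
  move=> [x y] _ /=.
  have [r r0 [c Pc]] : exists2 r : R, 0 < r & exists c, forall w,
      nrm (w - toC (x, y)) < r -> nrm w <= B -> P w c.
    have [xyB|Bxy] := leP (nrm (toC (x, y))) B.
      have [r r0 [c Pc]] := locP _ xyB; exists r => //; exists c => w wr _.
      exact: Pc.
    exists (nrm (toC (x, y)) - B); first by rewrite subr_gt0.
    exists 0 => w + wB; rewrite nrmC => wr; exfalso.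
    have := nrmD (toC (x, y) - w) w; rewrite subrK; lra.
  have r20 : 0 < r / 2 by rewrite divr_gt0.
  have nb (t : R) : nbhs t (ball t (r / 2)) by exact: nbhsx_ballx.
  exists (ball (x : R) (r / 2) `*` ball (y : R) (r / 2), [set c' | c <= c']).
    split; first by exists (ball (x : R) (r / 2), ball (y : R) (r / 2)); [split; exact: nb|].
    by exists c; split; [exact: num_real|move=> t /ltW].
  move=> [[x' y'] c'] /= [[/= bx by'] cc'] zB.
  apply: (monP _ _ _ cc'); apply: Pc => //.
  move: bx by'; rewrite -!ball_normE/= => bx by'.
  rewrite (le_lt_trans (nrm_Re_Im _))//= (distrC x') (distrC y') [ltRHS]splitr.
  exact: ltrD.
move=> M [_ HM].
exists (M + 1) => w wB.
have := HM (M + 1) _ (complex.Re w, complex.Im w).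
rewrite /toC/= -[Complex _ _]/(Complex (complex.Re w) (complex.Im w)).
have -> : Complex (complex.Re w) (complex.Im w) = w by case: (w).
apply=> //; first by rewrite ltrDl.
have ReB : `|complex.Re w| <= B.
  by rewrite (le_trans _ wB)// -lecR -nrmE normc_ge_Re.
have ImB : `|complex.Im w| <= B.
  rewrite (le_trans _ wB)// nrm.unlock normc_def/= -sqrtr_sqr ler_wsqrtr//.
  by rewrite lerDr sqr_ge0.
by split; rewrite /= in_itv/= -ler_norml.
Qed.

Section nonempty.
Context {R : realType} {H : hilbertType R}.
Implicit Types (S T : 'B(H)) (z : R[i]).

Lemma essnorm_exp T n : essnorm (T ^+ n) <= essnorm T ^+ n.
Proof.
elim: n => [|n IH]; first exact: le_trans (essnorm_le_nrm _) (nrm_1 _).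
by rewrite !exprS (le_trans (essnormM _ _))// ler_wpM2l ?essnorm_ge0.
Qed.

Lemma op_scaleM T z : T * z%:op = z *: T.
Proof. by rewrite opZr mulr1. Qed.

Lemma op_scaleMl T z : z%:op * T = z *: T.
Proof. by rewrite opZl mul1r. Qed.

Lemma resolvent_identity (a r1 r2 : 'B(H)) (m n : R[i]) :
  eqfin (r1 * (a - m%:op)) 1 -> eqfin ((a - n%:op) * r2) 1 ->
  eqfin (r1 - r2) ((m - n) *: (r1 * r2)).
Proof.
move=> r1E r2E.
have -> : (m - n) *: (r1 * r2) =
    r1 * ((a - n%:op) * r2) - (r1 * (a - m%:op)) * r2.
  rewrite -mulrA -mulrBr -mulrBl opprB.
  rewrite [_ + (m%:op - a)]addrC subrKA -scalerBl.
  by rewrite op_scaleMl opZr.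
by rewrite r1E r2E mulr1 mul1r.
Qed.

(** The identity of partial fractions
z / (b - z) + (- z) / (b + z) = 2 z^2 / (b^2 - z^2), for inverses modulo finite
rank. *)
Lemma average_step (b U1 U2 : 'B(H)) z :
  eqfin (U1 * (b - z%:op)) z%:op -> eqfin (U2 * (b + z%:op)) (- z%:op) ->
  eqfin ((2^-1 *: (U1 + U2)) * (b * b - (z * z)%:op)) (z * z)%:op.
Proof.
move=> U1E U2E.
have f1 : b * b - (z * z)%:op = (b - z%:op) * (b + z%:op).
  rewrite mulrDr !mulrBl !op_scaleM !op_scaleMl scalerA.
  by rewrite addrA subrK.
have f2 : b * b - (z * z)%:op = (b + z%:op) * (b - z%:op).
  rewrite mulrBr !mulrDl !op_scaleM !op_scaleMl scalerA.
  by rewrite opprD addrA addrK.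
rewrite opZl mulrDl {1}f1 f2 !mulrA U1E U2E mulNr -mulrBr opprB.
rewrite [_ + (z%:op - b)]addrC subrKA -scalerDl op_scaleM !scalerA.
suff -> : 2^-1 * ((z + z) * z) = z * z by [].
by field.
Qed.

(** Rickart's elementary substitute for Liouville's theorem.  If r is a
resolvent of a, the averages of z r(z) over the n-th roots of unity, n being a
power of 2, are z^n (a^n - z^n)^-1.  When |z| exceeds the spectral radius they
tend to -1; as z r(z) is uniformly continuous, they stay close to -1 for slightly
smaller |z|, which shows that the spectral radius is smaller too.  Iterating, it
is 0, but then a = a - 0 is not invertible.  All of this takes place modulo finite
rank operators. *)
Section rickart.
Context (a : 'B(H)) (r : R[i] -> 'B(H)).
Hypothesis rl : forall z, eqfin (r z * (a - z%:op)) 1.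
Hypothesis rr : forall z, eqfin ((a - z%:op) * r z) 1.
Context (B : R).

Let resolvent_bounded : exists K, forall z, nrm z <= B -> essnorm (r z) <= K.
Proof.
apply: disc_uniform; last by move=> w c c' cc' /le_trans; apply.
move=> z _; have d0 : 0 < 2 * (essnorm (r z) + 1).
  by rewrite mulr_gt0// ltr_wpDl ?essnorm_ge0.
exists (2 * (essnorm (r z) + 1))^-1; first by rewrite invr_gt0.
exists (2 * essnorm (r z)) => w wz.
have := resolvent_identity (rl w) (rr z) => /eqfin_essnorm wzE.
have := essnormD (r w - r z) (r z); rewrite subrK wzE.
have := essnormZ (w - z) (r w * r z).
have := essnormM (r w) (r z).
move: wz; rewrite -div1r ltr_pdivlMr//.
have := essnorm_ge0 (r w); have := essnorm_ge0 (r z); have := nrm_ge0 (w - z).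
move: (essnorm (r w)) (essnorm (r z)) (essnorm (r w * r z)) (nrm (w - z))
  (essnorm ((w - z) *: (r w * r z))) => p q pq e x.
nra.
Qed.

Let oscillation : exists2 d : R, 0 < d & forall z w, nrm z <= B -> nrm w <= B ->
  nrm (z - w) <= d -> essnorm (z *: r z - w *: r w) <= 1 / 4.
Proof.
have [K K_ge0 HK] : exists2 K : R, 0 <= K &
    forall z, nrm z <= B -> essnorm (r z) <= K.
  have [K HK] := resolvent_bounded.
  exists (maxr K 0); first by rewrite le_max lexx orbT.
  by move=> z /HK/le_trans; apply; rewrite le_max lexx.
have [B' B'_ge0 BB'] : exists2 B' : R, 0 <= B' & B <= B'.
  by exists (maxr B 0); rewrite le_max lexx ?orbT.
have C0 : 0 < 4 * (K + B' * K ^+ 2 + 1).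
  by rewrite mulr_gt0// ltr_wpDl// addr_ge0// mulr_ge0// sqr_ge0.
exists (4 * (K + B' * K ^+ 2 + 1))^-1; first by rewrite invr_gt0.
move=> z w zB wB; rewrite -div1r ler_pdivlMr// => zw.
have -> : z *: r z - w *: r w = (z - w) *: r z + w *: (r z - r w).
  by rewrite scalerBl scalerBr subrKA.
have E : eqfin ((z - w) *: r z + w *: (r z - r w))
    ((z - w) *: (r z + w *: (r z * r w))).
  by rewrite (resolvent_identity (rl z) (rr w)) scalerDr !scalerA (mulrC w).
rewrite (eqfin_essnorm E) (le_trans (essnormZ _ _))//.
have := essnormD (r z) (w *: (r z * r w)).
have := essnormZ w (r z * r w).
have := essnormM (r z) (r w).
have := HK _ zB; have := HK _ wB; have := le_trans wB BB'.
have := essnorm_ge0 (r z); have := essnorm_ge0 (r w).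
have := nrm_ge0 (z - w); have := nrm_ge0 w.
move: zw.
move: (essnorm (r w)) (essnorm (r z)) (essnorm (r z * r w)) (nrm (z - w)) (nrm w)
  (essnorm (r z + w *: (r z * r w))) (essnorm (w *: (r z * r w))).
move=> p q pq e m x y ekb m0 e0 p0 q0 mb pk qk pqq ympq xqy.
have h1 : q * p <= K ^+ 2 by rewrite expr2 ler_pM.
have h2 : m * pq <= B' * K ^+ 2.
  rewrite (le_trans (ler_wpM2l m0 pqq))// ler_pM//.
  by rewrite mulr_ge0.
have h3 : x <= K + B' * K ^+ 2 + 1 by lra.
have h4 : e * x <= e * (K + B' * K ^+ 2 + 1) by rewrite ler_wpM2l.
by lra.
Qed.


Let averages (d : R) :
  (forall z w, nrm z <= B -> nrm w <= B -> nrm (z - w) <= d ->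
     essnorm (z *: r z - w *: r w) <= 1 / 4) ->
  forall m z (s : R), 0 <= s <= 1 -> nrm z <= B -> nrm (z - s%:C * z) <= d ->
  let n := (2 ^ m)%N in exists U U',
    [/\ eqfin (U * (a ^+ n - (z ^+ n)%:op)) (z ^+ n)%:op,
        eqfin (U' * (a ^+ n - ((s%:C * z) ^+ n)%:op)) ((s%:C * z) ^+ n)%:op &
        essnorm (U - U') <= 1 / 4].
Proof.
move=> osc; elim=> [|m IH] z s /[dup] s01 /andP[s0 s1] zB zd.
  exists (z *: r z), ((s%:C * z) *: r (s%:C * z)); rewrite expn0 !expr1; split.
  - by rewrite opZl rl.
  - by rewrite opZl rl.
  - apply: osc => //; rewrite nrmM nrmR ger0_norm//.
    by rewrite (le_trans _ zB)// ler_piMl ?nrm_ge0.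
have n0 : (0 < 2 ^ m)%N by rewrite expn_gt0.
pose w : R[i] := (2 ^ m).-root (-1).
have wn : w ^+ (2 ^ m) = -1 by rewrite rootCK.
have w1 : nrm w = 1.
  have : nrm w ^+ (2 ^ m) = 1 by rewrite -nrmX wn nrmN nrm.unlock normr1.
  by move/eqP; rewrite pexpr_eq1 ?nrm_ge0// => /eqP.
have [U1 [U1' [U1E U1'E U1d]]] := IH z s s01 zB zd.
have wzB : nrm (w * z) <= B by rewrite nrmM w1 mul1r.
have wzd : nrm (w * z - s%:C * (w * z)) <= d.
  by rewrite mulrCA -mulrBr nrmM w1 mul1r.
have [U2 [U2' [U2E U2'E U2d]]] := IH (w * z) s s01 wzB wzd.
exists (2^-1 *: (U1 + U2)), (2^-1 *: (U1' + U2')).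
rewrite expnSr !exprM !expr2; split.
- apply: average_step => //.
  by move: U2E; rewrite exprMn wn mulN1r scaleNr opprK.
- apply: average_step => //.
  by move: U2'E; rewrite mulrCA exprMn wn mulN1r scaleNr opprK.
- rewrite -scalerBr opprD addrACA (le_trans (essnormZ _ _))//.
  rewrite nrmV (_ : nrm 2 = 2); last first.
    by rewrite -[2]/(2%:R) -(rmorph_nat (real_complex R)) nrmR ger0_norm.
  have := essnormD (U1 - U1') (U2 - U2').
  by move: U1d U2d; lra.
Qed.

(** With y = t^-n a^n, the average U at t satisfies U (y - 1) = 1, and y small
makes U close to -1.  Then so is the average U' at s, and solving
U' (y' - 1) = 1 for y' = s^-n a^n bounds y'. *)
Let growth_descends (d : R) :
  (forall z w, nrm z <= B -> nrm w <= B -> nrm (z - w) <= d ->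
     essnorm (z *: r z - w *: r w) <= 1 / 4) ->
  forall t s : R, 0 < s < t -> t <= B -> t - s <= d ->
  (exists m, essnorm (a ^+ (2 ^ m)) < t ^+ (2 ^ m)) ->
  exists m, essnorm (a ^+ (2 ^ m)) <= s ^+ (2 ^ m).
Proof.
move=> osc t s /andP[s0 st] tB tsd [m0 at0].
have t0 : 0 < t := lt_trans s0 st.
pose q := essnorm (a ^+ (2 ^ m0)) / t ^+ (2 ^ m0).
have q01 : 0 <= q < 1.
  rewrite divr_ge0 ?essnorm_ge0 ?exprn_ge0 ?(ltW t0)//=.
  by rewrite ltr_pdivrMr ?exprn_gt0// mul1r.
have [|k kH] := expr_small q01 (_ : 0 < 1 / 16); first by rewrite divr_gt0.
exists (m0 + k)%N; set n := (2 ^ (m0 + k))%N.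
have tn0 : 0 < t ^+ n by rewrite exprn_gt0.
have sn0 : 0 < s ^+ n by rewrite exprn_gt0.
have an : essnorm (a ^+ n) <= t ^+ n / 16.
  have : essnorm (a ^+ n) <= essnorm (a ^+ (2 ^ m0)) ^+ (2 ^ k).
    by rewrite /n expnD exprM essnorm_exp.
  move/le_trans; apply.
  have -> : essnorm (a ^+ (2 ^ m0)) = q * t ^+ (2 ^ m0).
    by rewrite /q divfK// gt_eqF// exprn_gt0.
  rewrite exprMn -exprM -expnD mulrC ler_wpM2l ?(ltW tn0)//.
  rewrite -div1r ltW// kH// ltnW// ltn_expl//.
have tB' : nrm (t%:C : R[i]) <= B by rewrite nrmR ger0_norm// ltW.
have stt : (s / t)%:C * t%:C = s%:C :> R[i].
  by rewrite -rmorphM divfK// gt_eqF.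
have st01 : 0 <= s / t <= 1.
  by rewrite divr_ge0 ?(ltW s0) ?(ltW t0)//= ler_pdivrMr// mul1r ltW.
have [|U [U' [UE U'E UU']]] := averages osc (m0 + k) st01 tB'.
  by rewrite stt -rmorphB nrmR ger0_norm// subr_ge0 ltW.
move: UE U'E; rewrite stt -/n -!rmorphXn/= => UE U'E.
pose y := (t ^+ n)^-1%:C *: a ^+ n; pose y' := (s ^+ n)^-1%:C *: a ^+ n.
have UyE : eqfin (U * y) (U + 1).
  rewrite /y -[X in eqfin (U * (_ *: X)) _](subrK (t ^+ n)%:C%:op).
  rewrite scalerDr mulrDr opZr UE !scalerA -rmorphM mulVf ?gt_eqF// scale1r.
  by rewrite mulr1 addrC.
have U'yE : eqfin (U' * y') (U' + 1).
  rewrite /y' -[X in eqfin (U' * (_ *: X)) _](subrK (s ^+ n)%:C%:op).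
  rewrite scalerDr mulrDr opZr U'E !scalerA -rmorphM mulVf ?gt_eqF// scale1r.
  by rewrite mulr1 addrC.
have y16 : essnorm y <= 1 / 16.
  rewrite (le_trans (essnormZ _ _))// nrmR gtr0_norm ?invr_gt0//.
  by rewrite mulrC ler_pdivrMr// mulrC; lra.
have le1 : essnorm (1 : 'B(H)) <= 1.
  exact: le_trans (essnorm_le_nrm _) (nrm_1 _).
have U1 : essnorm (U + 1) <= 1 / 4.
  have := essnormM U y; rewrite (eqfin_essnorm UyE).
  have := essnormB (U + 1) 1; rewrite addrK.
  have := essnorm_ge0 U; have := essnorm_ge0 y; nra.
have U'1 : essnorm (U' + 1) <= 1 / 2.
  have := essnormB (U + 1) (U - U').
  by rewrite opprB [_ + (U' - U)]addrC addrA subrK; lra.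
have y'1 : essnorm y' <= 1.
  have : eqfin y' ((U' + 1) * y' - (U' + 1)).
    by rewrite -[X in _ - X]U'yE mulrDl mul1r addrAC subrr add0r.
  move/eqfin_essnorm => y'E.
  have := essnormB ((U' + 1) * y') (U' + 1).
  have := essnormM (U' + 1) y'; rewrite -y'E.
  by have := essnorm_ge0 y'; nra.
have -> : a ^+ n = (s ^+ n)%:C *: y'.
  by rewrite /y' scalerA -rmorphM mulfV ?gt_eqF// scale1r.
rewrite (le_trans (essnormZ _ _))// nrmR gtr0_norm//.
by rewrite ler_piMr// ltW.
Qed.

Lemma no_entire_resolvent : 0 < essnorm (1 : 'B(H)) -> B = nrm a + 1 -> False.
Proof.
move=> one0 BE.
have one1 : 1 <= essnorm (1 : 'B(H)).
  have := essnormM (1 : 'B(H)) 1; rewrite mulr1.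
  by rewrite -[leLHS]mulr1 ler_pM2l.
have [d d0 osc] := oscillation.
have B0 : 0 < B by rewrite BE ltr_wpDl ?nrm_ge0.
pose X (t : R) := exists m, essnorm (a ^+ (2 ^ m)) < t ^+ (2 ^ m).
have XB : X B.
  exists 0; rewrite expn0 !expr1 (le_lt_trans (essnorm_le_nrm _))//.
  by rewrite BE ltrDl.
have down t s : 0 < s < t -> t <= B -> t - s <= d / 2 -> X t -> X s.
  move=> /andP[s0 st] tB ts Xt.
  pose s' := maxr (s / 2) (s - d / 2).
  have s's : s' < s by rewrite gt_max; apply/andP; split; lra.
  have s'0 : 0 < s' by rewrite lt_max; apply/orP; left; lra.
  have ds' : s - d / 2 <= s' by rewrite le_max lexx orbT.
  have [||||m am] := @growth_descends d osc t s' => //.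
  - by rewrite s'0 (lt_trans s's).
  - lra.
  exists m; rewrite (le_lt_trans am)//.
  by rewrite ltr_pXn2r// ?nnegrE ?(ltW s'0) ?(ltW s0)// expn_gt0.
have Xk k s : 0 < s -> B - d / 2 *+ k < s -> s <= B -> X s.
  elim: k s => [|k IH] s s0; first by rewrite mulr0n subr0 => /lt_le_trans h /h; rewrite ltxx.
  rewrite mulrSr => ks sB; have [sdB|Bsd] := leP (s + d / 2) B.
    apply: (down (s + d / 2)) => //; last by apply: IH => //; lra.
      by rewrite s0/=; lra.
    by lra.
  move: sB; rewrite le_eqVlt => /orP[/eqP-> //|sB].
  by apply: (down B) => //; [rewrite s0|lra].
have Xall s : 0 < s -> s <= B -> X s.
  move=> s0 sB; pose k := (truncn (B / (d / 2))).+1.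
  apply: (Xk k) => //.
  have : B / (d / 2) < k%:R by exact: truncnS_gt.
  by rewrite ltr_pdivrMr ?divr_gt0// mulr_natl; lra.
pose s := minr B ((essnorm (r 0) + 1)^-1).
have r1 : 0 < essnorm (r 0) + 1 by rewrite ltr_wpDl ?essnorm_ge0.
have s0 : 0 < s by rewrite lt_min B0 invr_gt0.
have [|m am] := Xall s s0; first by rewrite ge_min lexx.
have rs : essnorm (r 0) * s < 1.
  have : s <= (essnorm (r 0) + 1)^-1 by rewrite ge_min lexx orbT.
  rewrite -div1r ler_pdivlMr//; have := essnorm_ge0 (r 0); nra.
have rn n : eqfin (r 0 ^+ n * a ^+ n) 1.
  elim: n => [|n IH]; first by rewrite !expr0 mulr1.
  have := rl 0; rewrite scale0r subr0 => r0.
  by rewrite exprSr exprS -mulrA [X in _ * X]mulrA r0 mul1r.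
have := eqfin_essnorm (rn (2 ^ m)%N).
have := essnormM (r 0 ^+ (2 ^ m)) (a ^+ (2 ^ m)).
have := essnorm_exp (r 0) (2 ^ m).
have rs1 : (essnorm (r 0) * s) ^+ (2 ^ m) < 1.
  by rewrite exprn_ilt1// ?mulr_ge0 ?essnorm_ge0 ?(ltW s0)// -lt0n expn_gt0.
move: rs1; rewrite exprMn.
have := essnorm_ge0 (a ^+ (2 ^ m)); have := essnorm_ge0 (r 0 ^+ (2 ^ m)).
have := exprn_ge0 (2 ^ m)%N (essnorm_ge0 (r 0)).
move: am.
move: (essnorm (r 0 ^+ (2 ^ m))) (essnorm (a ^+ (2 ^ m)))
  (essnorm (r 0 ^+ (2 ^ m) * a ^+ (2 ^ m))) (essnorm (r 0) ^+ (2 ^ m))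
  (s ^+ (2 ^ m)) (essnorm (1 : 'B(H))) one1 => p q pq e x o o1 qx e0 p0 q0 ex pe pqE pqo.
have : p * q <= e * x by rewrite ler_pM// ltW.
lra.
Qed.

End rickart.

(** Otherwise the inverses of the invertible operators congruent to the T - z
would form a resolvent of T on the whole complex plane, modulo finite rank. *)
Lemma ess_spectrum_nonempty (T : 'B(H)) : 0 < essnorm (1 : 'B(H)) ->
  exists z, ~ weyl (T - z%:op).
Proof.
move=> one0; apply: contrapT => noz.
have res z : exists r, eqfin (r * (T - z%:op)) 1 /\ eqfin ((T - z%:op) * r) 1.
  have [Z [Y [ZY YZ]] TZ] : weyl (T - z%:op).
    by apply: contrapT => nz; apply: noz; exists z.
  by exists Y; rewrite TZ ZY YZ.
have [r rH] := choice res.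
exact: (@no_entire_resolvent T r (fun z => (rH z).1) (fun z => (rH z).2) _ one0 erefl).
Qed.

End nonempty.

(** * Orthonormal sequences and approximate kernels *)

Section orthonormal.
Context {R : realType} {H : hilbertType R}.
Implicit Types (x y z u v : H) (S T : 'B(H)).
Local Notation "''[' x , y ]" := (inner x y) : ring_scope.

Lemma inner_suml I (r : seq I) (P : pred I) (F : I -> H) z :
  '[\sum_(i <- r | P i) F i, z] = \sum_(i <- r | P i) '[F i, z].
Proof.
by apply: (big_morph (fun x => '[x, z])) => [x y|]; rewrite ?innerDl ?inner0l.
Qed.

Lemma inner_sumr I (r : seq I) (P : pred I) (F : I -> H) z :
  '[z, \sum_(i <- r | P i) F i] = \sum_(i <- r | P i) '[z, F i].
Proof.
by apply: (big_morph (fun x => '[z, x])) => [x y|]; rewrite ?innerDr ?inner0r.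
Qed.

Lemma nrm_sqrB x y :
  nrm (x - y) ^+ 2 = nrm x ^+ 2 - complex.Re '[x, y] *+ 2 + nrm y ^+ 2.
Proof.
apply: complexI; rewrite -inner_nrm rmorphD rmorphB rmorphMn/= -!inner_nrm.
rewrite innerBl !innerBr (innerC y x) opprB addrA -mulr_natl -addcJ.
by ring.
Qed.

(** The Gram-Schmidt process: a new vector u contributes the rank one projection
along its component orthogonal to the previous ones. *)
Lemma finite_projection (s : seq H) : exists Q : 'B(H),
  [/\ finrank Q, forall x y, '[Q x, y] = '[x, Q y], Q * Q = Q &
      forall u, u \in s -> Q u = u].
Proof.
elim: s => [|u s [Q [fQ aQ QQ Qs]]].
  exists 0; split=> //; first exact: finrank0.
    by move=> x y; rewrite !boundedOp0 inner0l inner0r.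
  by rewrite mul0r.
have [w wE] : exists w, w = u - Q u by exists (u - Q u).
have Qw : Q w = 0 by rewrite wE linearB/= -opME QQ subrr.
have [w0|w0] := eqVneq w 0.
  exists Q; split=> // v; rewrite in_cons => /orP[/eqP->|/Qs//].
  by apply/eqP; rewrite eq_sym -subr_eq0 -wE w0.
have ww0 : '[w, w] != 0.
  by rewrite inner_nrm; apply/eqP => -[/eqP]; rewrite sqrf_eq0 gt_eqF// nrm_gt0.
have wwJ : ('[w, w]^-1)^* = '[w, w]^-1 by rewrite fmorphV/= -innerC.
have Qxw x : '[Q x, w] = 0 by rewrite aQ Qw inner0r.
exists (Q + '[w, w]^-1 *: rank1 w w); split.
- exact/finrankD/finrankZ/finrank_rank1.
- move=> x y; rewrite !boundedOpD !boundedOpZ !rank1E innerDl innerDr aQ.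
  rewrite !innerZl !innerZr wwJ -innerC; congr (_ + _ * _); exact: mulrC.
- apply: boundedOpP => x; rewrite opME !boundedOpD !boundedOpZ !rank1E.
  rewrite linearD/= !linearZ/= Qw !scaler0 addr0 -opME QQ innerDl Qxw add0r.
  rewrite !innerZl !scalerA; congr (_ + _ *: _).
  by move: '[x, w] '[w, w] ww0 => p q q0; field.
- move=> v; rewrite in_cons boundedOpD boundedOpZ rank1E => /orP[/eqP->|/Qs vs].
    rewrite (_ : '[u, w] = '[w, w]); last by rewrite {2}wE innerBl Qxw subr0.
    by rewrite scalerA mulVf// scale1r wE addrC subrK.
  by rewrite -{2}vs Qxw scale0r scaler0 addr0.
Qed.

(** A finite rank projection fixing s is not the identity, and maps some x - Q x
to 0. *)
Lemma exists_unit_orth : infinite_dimensional H -> forall s : seq H,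
  exists x, nrm x = 1 /\ forall u, u \in s -> '[x, u] = 0.
Proof.
move=> Hinf s; have [Q [[t QE] aQ QQ Qs]] := finite_projection s.
have [x xe] := Hinf (size t) (fun i => (nth (0, 0) t i).2).
have Qx : Q x != x.
  have := xe (fun i => '[x, (nth (0, 0) t i).1]); rewrite eq_sym.
  suff -> : Q x = \sum_(i < size t) '[x, (nth (0, 0) t i).1] *: (nth (0, 0) t i).2.
    by [].
  rewrite QE (big_nth (0, 0)) big_mkord.
  elim/big_ind2: _ => // a b c d; first by rewrite boundedOpD => -> ->.
have y0 : x - Q x != 0 by rewrite subr_eq0 eq_sym.
pose y := x - Q x; have Qy : Q y = 0 by rewrite /y linearB/= -opME QQ subrr.
exists ((nrm y)^-1%:C *: y); split.
  rewrite nrmZ nrmR ger0_norm ?invr_ge0 ?nrm_ge0// mulVf// gt_eqF//.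
  exact: nrm_gt0.
by move=> u us; rewrite innerZl -(Qs u us) -aQ Qy inner0l mulr0.
Qed.

Definition orthonormal (x : nat -> H) := forall m n, '[x m, x n] = (m == n)%:R.

(** Dependent choice, carrying along the list of the vectors already chosen. *)
Lemma orthonormal_choice (A : nat -> H -> Prop) :
  (forall n (s : seq H), exists x,
     [/\ nrm x = 1, forall u, u \in s -> '[x, u] = 0 & A n x]) ->
  exists2 x, orthonormal x & forall n, A n (x n).
Proof.
move=> ex.
have [g gP] := choice (fun p : nat * seq H => ex p.1 p.2).
pose fix l n : seq H := if n is k.+1 then g (k, l k) :: l k else [::].
pose x n := g (n, l n).
have xl m n : (m < n)%N -> x m \in l n.
  elim: n => // n IH; rewrite ltnS leq_eqVlt => /orP[/eqP->|/IH mn] /=.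
    by rewrite mem_head.
  by rewrite in_cons mn orbT.
exists x; last by move=> n; have [] := gP (n, l n).
move=> m n; have [mn|nm|->] := ltngtP m n.
- have [_ /(_ _ (xl _ _ mn))/= nm _] := gP (n, l n).
  by rewrite (inner0C nm).
- by have [_ /(_ _ (xl _ _ nm))] := gP (m, l m).
- by have [x1 _ _] := gP (n, l n); rewrite inner_nrm /x x1 expr1n.
Qed.

Lemma orthonormal_nrm (x : nat -> H) n : orthonormal x -> nrm (x n) = 1.
Proof.
move=> ox; have := ox n n; rewrite eqxx inner_nrm => -[/eqP].
by rewrite sqrf_eq1 => /orP[/eqP//|/eqP xn]; have := nrm_ge0 (x n); rewrite xn; lra.
Qed.

Lemma orthonormal_sum (x : nat -> H) (c : nat -> R[i]) (m n : nat) : orthonormal x ->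
  nrm (\sum_(m <= i < n) c i *: x i) ^+ 2 = \sum_(m <= i < n) nrm (c i) ^+ 2.
Proof.
move=> ox; have [nm|/ltnW mn] := leqP n m.
  by rewrite !big_geq// nrm0 expr0n.
rewrite -(subnKC mn); elim: (n - m)%N => [|k IH].
  by rewrite addn0 !big_geq// nrm0 expr0n.
rewrite addnS !big_nat_recr ?leq_addr//= -IH pythagoras.
  by rewrite nrmZ (orthonormal_nrm _ ox) mulr1.
rewrite innerZr inner_suml big1_seq ?mulr0// => i /=.
rewrite mem_index_iota => /andP[_ ik].
by rewrite innerZl ox ltn_eqF ?mulr0.
Qed.

Lemma bessel (x : nat -> H) v (m n : nat) : orthonormal x ->
  \sum_(m <= i < n) nrm '[v, x i] ^+ 2 <= nrm v ^+ 2.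
Proof.
move=> ox; set w := \sum_(m <= i < n) '[v, x i] *: x i.
rewrite -(orthonormal_sum _ m n ox) -/w.
have vw : '[v - w, w] = 0.
  rewrite {2}/w inner_sumr big1_seq// => i /=.
  rewrite mem_index_iota => /andP[mi ik].
  rewrite innerZr innerBl /w inner_suml (bigD1_seq i)/= ?mem_index_iota ?mi//;
    last exact: iota_uniq.
  rewrite innerZl ox eqxx mulr1 big1 ?addr0 ?subrr ?mulr0// => j ji.
  by rewrite innerZl ox (negPf ji) mulr0.
rewrite -[v in leRHS](subrK w) pythagoras// lerDr sqr_ge0//.
Qed.

Lemma monotone_cauchy (a : nat -> R) (M : R) :
  (forall m n, (m <= n)%N -> a m <= a n) -> (forall n, a n <= M) ->
  forall e, 0 < e -> exists N, forall m n, (N <= m)%N -> a n - a m < e.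
Proof.
move=> am aM e e0.
have sa : has_sup (range a).
  by split; [exists (a 0), 0|exists M => _ [n _ <-]].
have [_ [N _ <-] Ne] := sup_adherent e0 sa; exists N => m n Nm.
have : a n <= sup (range a) by apply: sup_upper_bound => //; exists n.
have := am _ _ Nm; lra.
Qed.

Lemma bessel_tail (x : nat -> H) v : orthonormal x -> forall e, 0 < e ->
  exists N, forall m n, (N <= m)%N ->
    \sum_(m <= i < n) nrm '[v, x i] ^+ 2 < e.
Proof.
move=> ox e e0.
have [|n|N NH] := @monotone_cauchy (fun n => \sum_(0 <= i < n) nrm '[v, x i] ^+ 2)
    (nrm v ^+ 2) _ _ _ e0.
- move=> m n mn; rewrite (@big_cat_nat _ _ _ m 0 n)//= lerDl sumr_ge0// => i _.
  exact: sqr_ge0.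
- exact: bessel.
exists N => m n Nm; have [nm|/ltnW mn] := leqP n m; first by rewrite big_geq.
have := NH m n Nm; rewrite (@big_cat_nat _ _ _ m 0 n)//=.
by rewrite addrAC subrr add0r.
Qed.

Lemma inner_orthonormal_small (x : nat -> H) v : orthonormal x -> forall e, 0 < e ->
  exists N, forall n, (N <= n)%N -> nrm '[x n, v] < e.
Proof.
move=> ox e e0; have [N NH] := bessel_tail v ox (exprn_gt0 2 e0).
exists N => n Nn; have := NH n n.+1 Nn; rewrite big_nat1.
rewrite ltr_pXn2r// ?nnegrE ?nrm_ge0 ?ltW// innerC.
by rewrite nrm.unlock norm_conjC.
Qed.

Lemma finrank_orthonormal_small (x : nat -> H) F : orthonormal x -> finrank F ->
  forall e, 0 < e -> exists N, forall n, (N <= n)%N -> nrm (F (x n)) < e.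
Proof.
move=> ox [s ->]; elim: s => [|[u v] s IH] e e0.
  by exists 0%N => n _; rewrite big_nil boundedOp0 nrm0.
have d0 : 0 < e / 2 / (nrm v + 1) by rewrite !divr_gt0// ltr_wpDl ?nrm_ge0.
have e20 : 0 < e / 2 by rewrite divr_gt0.
have [N1 H1] := IH _ e20; have [N2 H2] := inner_orthonormal_small u ox d0.
exists (maxn N1 N2) => n; rewrite geq_max => /andP[/H1 n1 /H2 n2].
rewrite big_cons boundedOpD rank1E/= (le_lt_trans (nrmD _ _))// [e]splitr.
apply: ler_ltD => //; rewrite nrmZ.
move: n2; rewrite ltr_pdivlMr ?ltr_wpDl ?nrm_ge0// => /ltW; apply: le_trans.
by rewrite ler_wpM2l ?nrm_ge0// lerDl.
Qed.

(** A finite rank operator tends to 0 along an orthonormal sequence, hence cannot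
compensate the vectors fixed by E. *)
Lemma essnorm_orthonormal (x : nat -> H) (E : 'B(H)) : orthonormal x ->
  (forall n, E (x n) = x n) -> 1 <= essnorm E.
Proof.
move=> ox Ex; apply: essnorm_ge => F fF; apply/ler_addgt0Pr => e e0.
have [N /(_ _ (leqnn N)) NF] := finrank_orthonormal_small ox fF e0.
have := nrm_op (E + F) (x N); rewrite (orthonormal_nrm _ ox) mulr1 boundedOpD Ex.
have := nrmB (x N + F (x N)) (F (x N)); rewrite addrK (orthonormal_nrm _ ox); lra.
Qed.

Lemma essnorm1_gt0 : infinite_dimensional H -> 0 < essnorm (1 : 'B(H)).
Proof.
move=> /exists_unit_orth ex.
have [n s|x ox _] := @orthonormal_choice (fun _ _ => True).
  by have [x [x1 xs]] := ex s; exists x.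
exact: lt_le_trans (essnorm_orthonormal ox _).
Qed.

(** For a suitable t > 0, the coercivity of T gives |x - t T x| <= q |x| with
q < 1, so that 1 - (1 - t T) = t T is invertible by the Neumann series. *)
Lemma coercive_unit T c : 0 < c ->
  (forall x, c * nrm x ^+ 2 <= complex.Re '[T x, x]) -> op_unit T.
Proof.
move=> c0 Tc; pose C := nrm T ^+ 2 + c ^+ 2.
have c20 : 0 < c ^+ 2 by rewrite exprn_gt0.
have C0 : 0 < C by rewrite ltr_wpDl// sqr_ge0.
pose t := c / C; have t0 : 0 < t by rewrite divr_gt0.
have tC : t * C = c by rewrite divfK// gt_eqF.
have t2 : t * nrm T ^+ 2 <= c.
  by rewrite -tC ler_wpM2l ?(ltW t0)// lerDl ltW.
have tc1 : t * c <= 1.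
  rewrite /t mulrAC -expr2 ler_pdivrMr// mul1r lerDr sqr_ge0//.
have q0 : 0 <= 1 - t * c by lra.
have tc0 : 0 < t * c by rewrite mulr_gt0.
have : nrm (1 - t%:C *: T) < 1.
  apply: (@le_lt_trans _ _ (Num.sqrt (1 - t * c))); last first.
    by rewrite -[ltRHS]sqrtr1 ltr_sqrt//; lra.
  apply: nrm_op_le => [|x]; first exact: sqrtr_ge0.
  rewrite -(@ler_pXn2r _ 2)// ?nnegrE ?mulr_ge0 ?sqrtr_ge0 ?nrm_ge0//.
  rewrite exprMn sqr_sqrtr// boundedOpB boundedOpZ op1E nrm_sqrB innerZr.
  rewrite innerC nrmZ nrmR gtr0_norm// exprMn.
  have -> : complex.Re ((t%:C)^* * ('[T x, x])^*)%R = t * complex.Re '[T x, x].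
    by case: '[T x, x] => p q; rewrite /conjc/=; ring.
  have : nrm (T x) ^+ 2 <= nrm T ^+ 2 * nrm x ^+ 2.
    by rewrite -exprMn ler_pXn2r ?nnegrE ?mulr_ge0 ?nrm_ge0// nrm_op.
  have := Tc x.
  move: (complex.Re _) (nrm (T x) ^+ 2) (nrm x ^+ 2) (sqr_ge0 (nrm x))
    => p q y y0 cp qT.
  have h1 : t * (c * y) <= t * p by rewrite ler_wpM2l// ltW.
  have h2 : t ^+ 2 * q <= t * c * y.
    rewrite expr2 -mulrA -mulrA ler_wpM2l ?(ltW t0)//.
    rewrite (le_trans (ler_wpM2l (ltW t0) qT))// mulrA.
    by rewrite ler_wpM2r.
  rewrite mulr2n; lra.
move/neumann; rewrite opprB addrC subrK => ut.
have -> : T = t^-1%:C *: (t%:C *: T).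
  by rewrite scalerA -rmorphM mulVf ?gt_eqF// scale1r.
apply: op_unitZ => //; apply/eqP => -[/eqP].
by rewrite invr_eq0 gt_eqF.
Qed.

(** Let Q be a finite rank projection fixing s and X = T (1 - Q).  Then
X^* X + Q is coercive, and (X^* X + Q)^-1 X^* is the desired left inverse, as T is
X modulo finite rank. *)
Lemma left_inverse_mod_finrank T (s : seq H) (d : R) : 0 < d ->
  (forall x, (forall u, u \in s -> '[x, u] = 0) -> d * nrm x <= nrm (T x)) ->
  exists L, eqfin (L * T) 1.
Proof.
move=> d0 Td; have [Q [fQ aQ QQ Qs]] := finite_projection s.
pose X := T * (1 - Q); pose Y := adjoint X * X + Q.
have QP x : '[Q x, x - Q x] = 0.
  by rewrite aQ linearB/= -opME QQ subrr inner0r.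
have [||Z [YZ ZY]] := @coercive_unit Y (minr (d ^+ 2) 1).
- by rewrite lt_min exprn_gt0//= ltr01.
- move=> x; rewrite /Y boundedOpD innerDl opME adjoint_inner inner_nrm.
  have -> : '[Q x, x] = (nrm (Q x) ^+ 2)%:C.
    by rewrite -inner_nrm; apply/eqP; rewrite -subr_eq0 -innerBr QP.
  rewrite -rmorphD/=.
  have -> : nrm x ^+ 2 = nrm (x - Q x) ^+ 2 + nrm (Q x) ^+ 2.
    by rewrite -pythagoras ?subrK// (inner0C (QP x)).
  have : d ^+ 2 * nrm (x - Q x) ^+ 2 <= nrm (X x) ^+ 2.
    rewrite -exprMn ler_pXn2r ?nnegrE ?mulr_ge0 ?nrm_ge0 ?(ltW d0)//.
    by apply: Td => u us; rewrite innerBl -{1}(Qs u us) -aQ subrr.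
  have m1 : minr (d ^+ 2) 1 <= d ^+ 2 by rewrite ge_min lexx.
  have m2 : minr (d ^+ 2) 1 <= 1 by rewrite ge_min lexx orbT.
  move=> h; rewrite mulrDr lerD//.
    by rewrite (le_trans _ h)// ler_wpM2r ?sqr_ge0.
  by rewrite -[leRHS]mul1r ler_wpM2r ?sqr_ge0.
exists (Z * adjoint X).
have XT : eqfin T X.
  rewrite /eqfin /X mulrBr mulr1 opprB addrC subrK; exact: finrankMl.
rewrite -mulrA XT; rewrite -[X in eqfin _ X]ZY /Y; symmetry.
by rewrite (eqfin_add _ fQ).
Qed.

(** If the conclusion fails, T has a left inverse L modulo finite rank.  The
inverses Y of operators congruent to T - t then satisfy Y = L (1 + t Y), so that
they stay bounded as t tends to 0, and T Y = 1 + t Y is Weyl for small t; so is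
T. *)
Lemma approx_kernel T : ~ weyl T ->
  (forall e : R, 0 < e -> exists2 t : R, 0 < t < e & weyl (T - t%:C%:op)) ->
  forall (s : seq H) (d : R), 0 < d ->
  exists x, [/\ nrm x = 1, forall u, u \in s -> '[x, u] = 0 & nrm (T x) < d].
Proof.
move=> nT wT s d d0; apply: contrapT => noex; apply: nT.
have [x xs|L LT] := @left_inverse_mod_finrank T s d d0.
  have [->|x0] := eqVneq x 0; first by rewrite nrm0 mulr0 nrm_ge0.
  rewrite leNgt; apply/negP => Tx; apply: noex.
  have nx0 := nrm_gt0 x0.
  exists ((nrm x)^-1%:C *: x); split.
  - by rewrite nrmZ nrmR ger0_norm ?invr_ge0 ?nrm_ge0// mulVf// gt_eqF.
  - by move=> u /xs xu; rewrite innerZl xu mulr0.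
  - rewrite linearZ/= nrmZ nrmR ger0_norm ?invr_ge0 ?nrm_ge0//.
    by rewrite ltr_pdivrMl// mulrC.
have e0 : 0 < (4 * (essnorm L + 1))^-1.
  by rewrite invr_gt0 mulr_gt0// ltr_wpDl ?essnorm_ge0.
have [t /andP[t0 te] [V uV TV]] := wT _ e0.
have [Y [VY YV]] := uV.
have TY : eqfin (T * Y) (1 + t%:C *: Y).
  by rewrite -{1}[T](subrK t%:C%:op) TV mulrDl VY op_scaleMl.
have YE : eqfin Y (L * (1 + t%:C *: Y)).
  by rewrite -TY mulrA LT mul1r.
have Y2 : essnorm (t%:C *: Y) < 1.
  have := essnormZ t%:C Y; rewrite nrmR gtr0_norm//.
  have := eqfin_essnorm YE; rewrite mulrDr mulr1 opZr => yE.
  have h1 := essnormD L (t%:C *: (L * Y)).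
  have h2 := essnormZ t%:C (L * Y); rewrite nrmR gtr0_norm// in h2.
  have h3 := essnormM L Y.
  have l0 := essnorm_ge0 L; have y0 := essnorm_ge0 Y.
  move: te; rewrite -div1r ltr_pdivlMr ?mulr_gt0 ?ltr_wpDl// => tl.
  move: yE h1 h2 h3 l0 y0 tl.
  move: (essnorm (t%:C *: (L * Y))) (essnorm (L + _)) (essnorm (L * Y))
    (essnorm L) (essnorm Y) (essnorm (t%:C *: Y)) => p q ly l y z.
  move=> -> h1 h2 h3 l0 y0 tl h4.
  have : t * ly <= t * (l * q) by rewrite ler_wpM2l// ltW.
  nra.
have -> : T = T * 1 by rewrite mulr1.
rewrite -YV mulrA TY; apply: weylM; last exact: op_unit_weyl.
exact: weyl_neumann.
Qed.

End orthonormal.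

(** * Operators given by orthonormal series, and dense ranges *)

Lemma seq_to_bound (R : realType) (U : normedZmodType R[i]) (u : nat -> U) l M N :
  seq_to u l -> (forall n, (N <= n)%N -> nrm (u n) <= M) -> nrm l <= M.
Proof.
move=> ul uM; apply/ler_addgt0Pr => e e0; have [n nH] := ul e e0.
rewrite -(subrK (u (maxn n N)) l) (le_trans (nrmD _ _))// addrC lerD//.
  by rewrite uM// leq_maxr.
by rewrite ltW// nH// leq_maxl.
Qed.

Section series.
Context {R : realType} {H : hilbertType R}.
Implicit Types (u v w : H) (S T A B : 'B(H)).
Local Notation "''[' x , y ]" := (inner x y) : ring_scope.

Lemma seq_to_op A (s : nat -> H) l :
  seq_to s l -> seq_to (fun n => A (s n)) (A l).
Proof.
move=> sl e e0; have A1 : 0 < nrm A + 1 by rewrite ltr_wpDl ?nrm_ge0.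
have [N NH] := sl _ (divr_gt0 e0 A1); exists N => n /NH.
rewrite ltr_pdivlMr// -linearB/=; apply: le_lt_trans.
by rewrite (le_trans (nrm_op _ _))// mulrC ler_wpM2l ?nrm_ge0// lerDl.
Qed.

Lemma seq_to_inner (s : nat -> H) l w (c : R[i]) N : seq_to s l ->
  (forall n, (N <= n)%N -> '[s n, w] = c) -> '[l, w] = c.
Proof.
move=> sl sc; apply/eqP; rewrite -subr_eq0; apply/eqP/nrm_small0 => e e0.
have w1 : 0 < nrm w + 1 by rewrite ltr_wpDl ?nrm_ge0.
have [n nH] := sl _ (divr_gt0 e0 w1).
rewrite -(sc (maxn n N)) ?leq_maxr// -innerBl (le_trans (nrm_inner _ _))//.
have := nH _ (leq_maxl n N); rewrite ltr_pdivlMr// => /ltW; apply: le_trans.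
by rewrite ler_wpM2l ?nrm_ge0// lerDl.
Qed.

Definition psum (x y : nat -> H) v (n : nat) := \sum_(0 <= i < n) '[v, x i] *: y i.

(** The series of rank one operators with sum A converges pointwise but, for
orthonormal x and y, not in norm. *)
Definition series_op (x y : nat -> H) A := forall v, seq_to (psum x y v) (A v).

(** The partial sums at v are Cauchy because their increments have the same norm
as the corresponding pieces of the Bessel sum of v. *)
Lemma series_op_exists (x y : nat -> H) : orthonormal x -> orthonormal y ->
  exists2 A, nrm A <= 1 & series_op x y A.
Proof.
move=> ox oy.
have cvg v : exists l, seq_to (psum x y v) l.
  apply: nrm_complete => e e0.
  have [N NH] := bessel_tail v ox (exprn_gt0 2 e0).
  have step m n : (N <= m)%N -> (m <= n)%N -> nrm (psum x y v n - psum x y v m) < e.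
    move=> Nm mn; rewrite /psum (@big_cat_nat _ _ _ m 0 n)//= addrAC subrr add0r.
    rewrite -(@ltr_pXn2r _ 2)// ?nnegrE ?nrm_ge0 ?(ltW e0)//.
    by rewrite (orthonormal_sum _ _ _ oy) NH.
  exists N => m n Nm Nn; have [mn|/ltnW nm] := leqP m n.
    by rewrite nrmC step.
  by rewrite step.
have [A Acvg] := choice cvg.
have Abound v : nrm (A v) <= nrm v.
  apply: (seq_to_bound (N := 0) (Acvg v)) => n _.
  rewrite -(@ler_pXn2r _ 2)// ?nnegrE ?nrm_ge0//.
  by rewrite (orthonormal_sum _ _ _ oy) bessel.
have linA : linear A.
  move=> a u v; apply/eqP; rewrite -subr_eq0; apply/eqP/nrm_small0 => e e0.
  have d0 : 0 < e / (nrm a + 2) by rewrite divr_gt0// ltr_wpDl ?nrm_ge0.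
  have [N1 H1] := Acvg u _ d0; have [N2 H2] := Acvg v _ d0.
  have [N3 H3] := Acvg (a *: u + v) _ d0.
  pose n := maxn N1 (maxn N2 N3).
  have {H1} h1 := H1 n (leq_maxl _ _).
  have {H2} h2 : nrm (A v - psum x y v n) < e / (nrm a + 2).
    by apply: H2; rewrite !leq_max leqnn orbT.
  have {H3} h3 : nrm (A (a *: u + v) - psum x y (a *: u + v) n) < e / (nrm a + 2).
    by apply: H3; rewrite !leq_max leqnn !orbT.
  have E : psum x y (a *: u + v) n = a *: psum x y u n + psum x y v n.
    rewrite /psum scaler_sumr -big_split/=; apply: eq_bigr => i _.
    by rewrite innerDl innerZl scalerDl scalerA.
  have -> : A (a *: u + v) - (a *: A u + A v) =
      (A (a *: u + v) - psum x y (a *: u + v) n)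
      - (a *: (A u - psum x y u n) + (A v - psum x y v n)).
    have -> : a *: (A u - psum x y u n) + (A v - psum x y v n) =
        (a *: A u + A v) - psum x y (a *: u + v) n.
      by rewrite E scalerBr addrACA opprD.
    by rewrite opprB subrKA.
  rewrite (le_trans (nrmB _ _))//.
  have := nrmD (a *: (A u - psum x y u n)) (A v - psum x y v n).
  rewrite nrmZ.
  have h4 := ler_wpM2l (nrm_ge0 a) (ltW h1).
  have : e = (nrm a + 2) * (e / (nrm a + 2)).
    by rewrite mulrC divfK// gt_eqF// ltr_wpDl ?nrm_ge0.
  lra.
have bA : A \in @bounded_linear R H.
  apply/asboolP; split=> //; exists 1%:C => v.
  by rewrite !nrmE -rmorphM lecR mul1r.
exists (BoundedOp bA); last exact: Acvg.
by apply: nrm_op_le => // v; rewrite mul1r; exact: Abound.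
Qed.

Lemma psum_basis (x y : nat -> H) (j n : nat) : orthonormal x -> (j < n)%N ->
  psum x y (x j) n = y j.
Proof.
move=> ox jn; rewrite /psum (bigD1_seq j)/= ?mem_index_iota ?iota_uniq//.
rewrite ox eqxx scale1r big1 ?addr0// => i ij.
by rewrite ox eq_sym (negPf ij) scale0r.
Qed.

Lemma inner_psum (x y : nat -> H) v (j n : nat) : orthonormal y -> (j < n)%N ->
  '[psum x y v n, y j] = '[v, x j].
Proof.
move=> oy jn; rewrite /psum inner_suml (bigD1_seq j)/= ?mem_index_iota ?iota_uniq//.
rewrite innerZl oy eqxx mulr1 big1 ?addr0// => i ij.
by rewrite innerZl oy (negPf ij) mulr0.
Qed.

Section one_series.
Context (x y : nat -> H) (X : 'B(H)).
Hypotheses (ox : orthonormal x) (oy : orthonormal y) (Xxy : series_op x y X).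

Lemma series_op_basis n : X (x n) = y n.
Proof.
apply/eqP; rewrite -subr_eq0; apply/eqP/nrm_small0 => e e0.
have [N NH] := Xxy (x n) e0.
have := NH (maxn N n.+1) (leq_maxl _ _).
by rewrite psum_basis ?leq_maxr// => /ltW.
Qed.

Lemma series_op_orth v : (forall n, '[v, x n] = 0) -> X v = 0.
Proof.
move=> v0; apply/nrm0_eq0/eqP; rewrite eq_le nrm_ge0 andbT.
apply: (seq_to_bound (N := 0) (Xxy v)) => n _.
by rewrite /psum big1 ?nrm0// => i _; rewrite v0 scale0r.
Qed.

Lemma series_op_ext A B : (forall n, A (y n) = B (y n)) -> A * X = B * X.
Proof.
move=> AB; apply: boundedOpP => v; apply/eqP; rewrite -subr_eq0 -boundedOpB.
rewrite -mulrBl opME; apply/eqP/nrm0_eq0/eqP; rewrite eq_le nrm_ge0 andbT.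
apply: (seq_to_bound (N := 0) (seq_to_op (A - B) (Xxy v))) => n _.
rewrite boundedOpB (_ : A _ = B (psum x y v n)) ?subrr ?nrm0//.
rewrite /psum !linear_sum; apply: eq_bigr => i _.
by rewrite !linearZ/= AB.
Qed.

Lemma adjoint_series_op_basis n : adjoint X (y n) = x n.
Proof.
apply: inner_extl => w; rewrite -adjointP.
by apply: (seq_to_inner (N := n.+1) (Xxy w)) => m nm; rewrite inner_psum.
Qed.

Lemma adjoint_series_op_orth v : (forall n, '[y n, v] = 0) -> adjoint X v = 0.
Proof.
move=> v0; apply: inner_extl => w; rewrite -adjointP inner0r.
apply: (seq_to_inner (N := 0) (Xxy w)) => m _.
by rewrite /psum inner_suml big1// => i _; rewrite innerZl v0 mulr0.
Qed.

(** When x and y are orthonormal, X maps the closed span of x isometrically to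
that of y and kills the orthogonal complement, so this is the orthogonal projection
onto the closed span of x. *)
Definition series_proj : 'B(H) := adjoint X * X.

Lemma adjoint_proj : adjoint series_proj = series_proj.
Proof. by rewrite /series_proj adjointM adjointK. Qed.

Lemma proj_basis n : series_proj (x n) = x n.
Proof. by rewrite /series_proj opME series_op_basis adjoint_series_op_basis. Qed.

Lemma proj_orth v n : '[v - series_proj v, x n] = 0.
Proof. by rewrite innerBl adjointP adjoint_proj proj_basis subrr. Qed.

Lemma series_op_proj : X * series_proj = X.
Proof.
apply: boundedOpP => v; apply/eqP; rewrite eq_sym -subr_eq0 opME -linearB/=.
by apply/eqP/series_op_orth; exact: proj_orth.
Qed.

Lemma proj_idem : series_proj * series_proj = series_proj.
Proof. by rewrite {1}/series_proj -mulrA series_op_proj. Qed.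

Lemma proj_psum v : seq_to (psum x x v) (series_proj v).
Proof.
rewrite /series_proj opME.
have -> : psum x x v = (fun n => adjoint X (psum x y v n)).
  apply/funext => n; rewrite /psum linear_sum/=; apply: eq_bigr => i _.
  by rewrite linearZ/= adjoint_series_op_basis.
exact: seq_to_op.
Qed.

Lemma nrm_proj_tail A (c : R) N : 0 <= c ->
  (forall n, nrm (A (x n)) <= c * (1 / 2) ^+ n) ->
  nrm (A * series_proj - \sum_(0 <= i < N) rank1 (x i) (A (x i)))
    <= 2 * c * (1 / 2) ^+ N.
Proof.
move=> c0 Ac; have h0 : 0 <= 1 / 2 :> R by rewrite divr_ge0.
apply: nrm_op_le => [|v]; first by rewrite !mulr_ge0// exprn_ge0.
have ApE n : A (psum x x v n) = \sum_(0 <= i < n) '[v, x i] *: A (x i).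
  by rewrite /psum linear_sum; apply: eq_bigr => i _; rewrite linearZ.
have sE : (\sum_(0 <= i < N) rank1 (x i) (A (x i))) v = A (psum x x v N).
  rewrite ApE; elim/big_ind2: _ => // a b d e.
  by rewrite boundedOpD => -> ->.
rewrite boundedOpB sE opME.
have cvg : seq_to (fun n => A (psum x x v n) - A (psum x x v N))
    (A (series_proj v) - A (psum x x v N)).
  move=> e e0; have [M MH] := seq_to_op A (proj_psum v) e0.
  by exists M => n /MH; rewrite opprB addrA subrK.
apply: (seq_to_bound (N := N) cvg) => n Nn.
rewrite !ApE (@big_cat_nat _ _ _ N 0 n)//= addrAC subrr add0r.
rewrite (le_trans (nrm_sum _ _))//.
have geo k : \sum_(N <= i < N + k) (1 / 2 : R) ^+ i
    = 2 * (1 / 2) ^+ N * (1 - (1 / 2) ^+ k).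
  elim: k => [|k IH]; first by rewrite addn0 big_geq// expr0 subrr mulr0.
  by rewrite addnS big_nat_recr ?leq_addr//= IH exprD exprS; field.
apply: (@le_trans _ _ (\sum_(N <= i < n) nrm v * c * (1 / 2) ^+ i)).
  apply: ler_sum => i _; rewrite nrmZ -mulrA ler_pM ?nrm_ge0//.
  by apply: nrm_inner_unit; exact: orthonormal_nrm.
rewrite -mulr_sumr -(subnKC Nn) geo.
have : 0 <= nrm v * c by rewrite mulr_ge0 ?nrm_ge0.
have p0 : 0 <= (1 / 2 : R) ^+ N by rewrite exprn_ge0.
have q0 : 0 <= (1 / 2 : R) ^+ (n - N) by rewrite exprn_ge0.
move: p0 q0; move: ((1 / 2) ^+ N) ((1 / 2) ^+ (n - N)) (nrm v) => p q t p0 q0 tc.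
have := mulr_ge0 (mulr_ge0 tc p0) q0; lra.
Qed.

(** The finite partial sums of the series defining A P approximate it in norm, so
A P is compact, in the closure of the finite rank operators. *)
Lemma essnorm_proj_summable A (c : R) : 0 <= c ->
  (forall n, nrm (A (x n)) <= c * (1 / 2) ^+ n) -> essnorm (A * series_proj) = 0.
Proof.
move=> c0 Ac; apply/eqP; rewrite eq_le essnorm_ge0 andbT.
apply/ler_addgt0Pr => e e0; rewrite add0r.
have d0 : 0 < e / (2 * c + 1) by rewrite divr_gt0// ltr_wpDl// mulr_ge0.
have h01 : 0 <= (1 / 2 : R) < 1.
  by apply/andP; split; lra.
have [N /(_ _ (leqnn N)) NH] := expr_small h01 d0.
apply: (@le_trans _ _ (2 * c * (1 / 2) ^+ N)).
  rewrite (le_trans _ (nrm_proj_tail N c0 Ac))//; apply: essnorm_le.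
  apply: finrankN; elim/big_ind: _ => [|a b|i _]; first exact: finrank0.
    exact: finrankD.
  exact: finrank_rank1.
move: NH; rewrite ltr_pdivlMr; last by rewrite ltr_wpDl// mulr_ge0.
have : 0 <= (1 / 2 : R) ^+ N by rewrite exprn_ge0//; lra.
lra.
Qed.

End one_series.

Definition in_cl_range A a := forall e : R, 0 < e -> exists v, nrm (A v - a) < e.

Definition dense_range A := forall a, in_cl_range A a.

Lemma in_cl_range_img A v : in_cl_range A (A v).
Proof. by move=> e e0; exists v; rewrite subrr nrm0. Qed.

Lemma in_cl_rangeD A a b : in_cl_range A a -> in_cl_range A b -> in_cl_range A (a + b).
Proof.
move=> Aa Ab e e0; have e20 : 0 < e / 2 by rewrite divr_gt0.
have [v va] := Aa _ e20; have [w wb] := Ab _ e20; exists (v + w).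
by rewrite linearD/= opprD addrACA (le_lt_trans (nrmD _ _))// [e]splitr ltrD.
Qed.

Lemma in_cl_rangeZ A (c : R[i]) a : in_cl_range A a -> in_cl_range A (c *: a).
Proof.
move=> Aa e e0; have c1 : 0 < nrm c + 1 by rewrite ltr_wpDl ?nrm_ge0.
have [v va] := Aa _ (divr_gt0 e0 c1); exists (c *: v).
move: va; rewrite ltr_pdivlMr// linearZ/= -scalerBr nrmZ; apply: le_lt_trans.
by rewrite mulrC ler_wpM2l ?nrm_ge0// lerDl.
Qed.

Lemma in_cl_range_lim A (s : nat -> H) l : seq_to s l ->
  (forall n, in_cl_range A (s n)) -> in_cl_range A l.
Proof.
move=> sl As e e0; have e20 : 0 < e / 2 by rewrite divr_gt0.
have [N /(_ _ (leqnn N)) NH] := sl _ e20; have [v vs] := As N _ e20.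
exists v; rewrite (le_lt_trans (nrm_tri (s N) _ _))// [e]splitr ltrD//.
by rewrite nrmC.
Qed.

Lemma dense_range_unitM Z A : op_unit Z -> dense_range A -> dense_range (Z * A).
Proof.
move=> [Y [ZY YZ]] dA a e e0; have Z1 : 0 < nrm Z + 1 by rewrite ltr_wpDl ?nrm_ge0.
have [v va] := dA (Y a) _ (divr_gt0 e0 Z1); exists v.
move: va; rewrite ltr_pdivlMr//; apply: le_lt_trans.
have aE : a = Z (Y a) by rewrite -opME ZY.
rewrite {1}aE opME -linearB/= (le_trans (nrm_op _ _))//.
by rewrite mulrC ler_wpM2l ?nrm_ge0// lerDl.
Qed.

Lemma dense_range_Munit Z A : op_unit Z -> dense_range A -> dense_range (A * Z).
Proof.
move=> [Y [ZY YZ]] dA a e e0; have [v va] := dA a e e0; exists (Y v).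
by rewrite opME -[Z _]opME ZY.
Qed.

(** A vector of the kernel of A is orthogonal to the range of its adjoint. *)
Lemma dense_range_adjoint_inj A v : dense_range (adjoint A) -> A v = 0 -> v = 0.
Proof.
move=> dA Av; apply: nrm_small0 => e e0; have [w wv] := dA v e e0.
have [->|v0] := eqVneq v 0; first by rewrite nrm0 ltW.
have nv0 := nrm_gt0 v0; rewrite -(ler_pM2l nv0) -expr2 -lecR -inner_nrm.
have : '[v, v] = '[v, v - adjoint A w].
  by rewrite innerBr -adjointP Av inner0l subr0.
move=> vE; rewrite -[leLHS]ger0_norm ?dnorm_ge0// nrmE lecR vE.
rewrite (le_trans (nrm_inner _ _))// ler_wpM2l ?nrm_ge0// nrmC ltW//.
Qed.

End series.

(** * Pushing the Weyl spectrum to the right *)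

(** X is the isometry of the closed span of x that sends x n to x (2 n + 1): a
unilateral shift of infinite multiplicity, since infinitely many basis vectors,
those of even index, are orthogonal to its range. *)
Section shift.
Context {R : realType} {H : hilbertType R}.
Local Notation "''[' x , y ]" := (inner x y) : ring_scope.
Context (x : nat -> H) (X : 'B(H)).
Hypotheses (ox : orthonormal x) (Xx : series_op x (fun n => x n.*2.+1) X).

Let P := series_proj X.
Let S := adjoint X.

Let oy : orthonormal (fun n => x n.*2.+1).
Proof. by move=> m n; rewrite ox eqSS -!muln2 eqn_pmul2r. Qed.

Lemma shift_even n : S (x n.*2) = 0.
Proof.
apply: (adjoint_series_op_orth Xx) => m; rewrite ox.
by rewrite (_ : _ == _ = false)//; apply/eqP => /(congr1 odd); rewrite /= !odd_double.
Qed.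

Lemma shift_odd n : S (x n.*2.+1) = x n.
Proof. exact: (adjoint_series_op_basis oy Xx). Qed.

Lemma shift_basis n : X (x n) = x n.*2.+1.
Proof. exact: (series_op_basis ox Xx). Qed.

Lemma shiftXP : X * P = X. Proof. exact: (series_op_proj ox oy Xx). Qed.

Lemma shiftPX : P * X = X.
Proof.
rewrite -[RHS]mul1r; apply: (series_op_ext Xx) => n.
by rewrite (proj_basis ox oy Xx).
Qed.

Lemma shiftSP : S * P = S.
Proof. by rewrite -[X in _ * X](adjoint_proj X) -adjointM shiftPX. Qed.

Lemma shiftPS : P * S = S.
Proof. by rewrite -[X in X * _](adjoint_proj X) -adjointM shiftXP. Qed.

(** P - X S is the projection onto the orthogonal complement, within the closed
span of x, of the range of X. *)
Lemma shift_defect : 1 <= essnorm (P - X * S).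
Proof.
apply: (@essnorm_orthonormal _ _ (fun n => x n.*2)) => [m n|n].
  by rewrite ox -!muln2 eqn_pmul2r.
by rewrite boundedOpB opME shift_even linear0 subr0 (proj_basis ox oy Xx).
Qed.

Lemma dense_range_basis A :
  (forall n, in_cl_range A (x n)) -> (forall v, P v = 0 -> in_cl_range A v) ->
  dense_range A.
Proof.
move=> Ax A0 a; rewrite -(subrK (P a) a); apply: in_cl_rangeD.
  apply: A0; rewrite linearB; apply/eqP; rewrite subr_eq0; apply/eqP.
  by have /(congr1 (fun T : 'B(H) => T a)) := proj_idem ox oy Xx.
apply: (in_cl_range_lim (proj_psum oy Xx a)) => n.
rewrite /psum; elim/big_ind: _ => [|u v|i _].
- by rewrite -(linear0 A); exact: in_cl_range_img.
- exact: in_cl_rangeD.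
- exact: in_cl_rangeZ.
Qed.

(** Powers of S kill each basis vector, so that x n is the image under 1 - S of
the finite sum of the S^k (x n). *)
Lemma dense_range_1S : dense_range (1 - S).
Proof.
apply: dense_range_basis => [n|v Pv]; last first.
  have -> : v = (1 - S) v.
    by rewrite boundedOpB -shiftSP opME Pv linear0 subr0.
  exact: in_cl_range_img.
have [m] := ubnP n; elim: m n => // m IH n nm.
have -> : x n = (1 - S) (x n) + S (x n) by rewrite boundedOpB subrK.
apply: in_cl_rangeD; first exact: in_cl_range_img.
have := odd_double_half n; case: (odd n) => nE; rewrite -nE.
  by rewrite add1n shift_odd; apply: IH; lia.
by rewrite add0n shift_even -(linear0 (1 - S)); exact: in_cl_range_img.
Qed.

(** Along the orbit z k = X^k (x N), the differences x N - z k are in the range of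
1 - X, hence so are their averages.  These converge to x N: the z k are
orthonormal, so that the average of n of them has norm n^(-1/2). *)
Lemma dense_range_1X : dense_range (1 - X).
Proof.
apply: dense_range_basis => [N|v Pv]; last first.
  have -> : v = (1 - X) v.
    by rewrite boundedOpB -shiftXP opME Pv linear0 subr0.
  exact: in_cl_range_img.
pose f n := n.*2.+1; pose z k := x (iter k f N).
have itlt k m : (k < m)%N -> (iter k f N < iter m f N)%N.
  elim: m => // m IH; rewrite ltnS leq_eqVlt iterS => /orP[/eqP->|/IH].
    by rewrite /f; lia.
  by rewrite /f; lia.
have oz : orthonormal z.
  move=> k m; rewrite /z ox; congr (nat_of_bool _)%:R.
  have [km|mk|->] := ltngtP k m; last by rewrite eqxx.
    by rewrite ltn_eqF// itlt.
  by rewrite gtn_eqF// itlt.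
have diff k : in_cl_range (1 - X) (x N - z k).
  elim: k => [|k IH].
    by rewrite subrr -(linear0 (1 - X)); exact: in_cl_range_img.
  rewrite -(subrKA (z k)); apply: in_cl_rangeD => //.
  rewrite /z iterS -shift_basis -/(z k).
  by rewrite -[z k - X (z k)]/((1 - X) (z k)); exact: in_cl_range_img.
pose s n := (n.+1%:R^-1 : R)%:C *: \sum_(0 <= k < n.+1) (x N - z k).
apply: (@in_cl_range_lim _ _ _ s); last first.
  move=> n; apply: in_cl_rangeZ; elim/big_ind: _ => [|u v|i _].
  - by rewrite -(linear0 (1 - X)); exact: in_cl_range_img.
  - exact: in_cl_rangeD.
  - exact: diff.
move=> e e0; exists (truncn (e ^- 2)) => n Nn.
have n0 : (n.+1%:R : R) != 0 by rewrite pnatr_eq0.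
have -> : x N - s n = (n.+1%:R^-1 : R)%:C *: \sum_(0 <= k < n.+1) 1 *: z k.
  rewrite /s sumrB scalerBr opprB addrC big_const_nat subn0 iter_addr_0.
  rewrite -[x N *+ _]scaler_nat scalerA -(rmorph_nat (real_complex R)) -rmorphM mulVf//.
  rewrite scale1r subrK; congr (_ *: _).
  by apply: eq_bigr => k _; rewrite scale1r.
rewrite -(@ltr_pXn2r _ 2)// ?nnegrE ?nrm_ge0 ?(ltW e0)// nrmZ exprMn.
rewrite (orthonormal_sum _ _ _ oz) nrmR ger0_norm//.
rewrite (eq_bigr (fun=> 1)); last first.
  by move=> i _; rewrite nrm.unlock normr1 expr1n.
rewrite big_const_nat subn0 iter_addr_0 expr2 -mulrA mulVf// mulr1.
have : e ^- 2 < n.+1%:R.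
  by apply: lt_le_trans (truncnS_gt _) _; rewrite ler_nat ltnS.
by rewrite invf_plt ?posrE ?exprn_gt0 ?ltr0Sn.
Qed.

End shift.

Section perturbation.
Context {R : realType} {H : hilbertType R}.
Implicit Types (V T X S P Z : 'B(H)).
Local Notation "''[' x , y ]" := (inner x y) : ring_scope.

(** If V + E is W^-1 modulo finite rank, then the right inverse Y of V bounds the
essential norm of W when E is small, and W V = 1 - W E is close to 1: this is not
compatible with V G = 0. *)
Lemma not_weyl_near V Y G : eqfin (V * Y) 1 -> eqfin (V * G) 0 ->
  0 < essnorm G ->
  exists2 d : R, 0 < d & forall E, essnorm E < d -> ~ weyl (V + E).
Proof.
move=> VY VG G0; have d0 : 0 < 4 * (essnorm Y + 1).
  by rewrite mulr_gt0// ltr_wpDl ?essnorm_ge0.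
exists (4 * (essnorm Y + 1))^-1; first by rewrite invr_gt0.
move=> E; rewrite -div1r ltr_pdivlMr// => Ed [Z [W [ZW WZ]] VEZ].
have WV : eqfin (W * V) (1 - W * E).
  by rewrite -[V in W * V](addrK E) mulrBr VEZ WZ.
have WE : eqfin W (Y - W * E * Y).
  by rewrite -[X in eqfin X _]mulr1 -VY mulrA WV mulrBl mul1r.
have GE : eqfin G (W * E * G).
  have : eqfin (W * (V * G)) 0 by rewrite VG mulr0.
  rewrite mulrA WV mulrBl mul1r => h.
  by rewrite -[X in eqfin X _](subrK (W * E * G)) h add0r.
have h1 := essnormB Y (W * E * Y); rewrite -(eqfin_essnorm WE) in h1.
have h2 := essnormM (W * E) Y; have h3 := essnormM W E.
have h4 := essnormM (W * E) G; rewrite -(eqfin_essnorm GE) in h4.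
have w0 := essnorm_ge0 W; have e0 := essnorm_ge0 E; have y0 := essnorm_ge0 Y.
have we0 := essnorm_ge0 (W * E).
move: (essnorm W) (essnorm E) (essnorm Y) (essnorm (W * E)) (essnorm (W * E * Y))
  (essnorm G) w0 e0 y0 we0 h1 h2 h3 h4 Ed G0 => w e y we wey g.
move=> w0 e0 y0 we0 h1 h2 h3 h4 Ed g0.
have ley : 1 <= we.
  by rewrite -(ler_pM2r g0) mul1r.
have : we * y <= w * e * y by rewrite ler_wpM2r.
nra.
Qed.

Lemma rank1_unit (u v : H) : 1 + '[v, u] != 0 -> op_unit (1 + rank1 u v).
Proof.
move=> n0; set c := 1 + _ in n0.
have rr : rank1 u v * rank1 u v = '[v, u] *: rank1 u v.
  by rewrite mul_op_rank1 rank1E scale_rank1.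
exists (1 - c^-1 *: rank1 u v).
have E : c^-1 + c^-1 * '[v, u] = 1 by rewrite -[X in X + _]mulr1 -mulrDr mulVf.
have E2 : rank1 u v - (c^-1 *: rank1 u v + (c^-1 * '[v, u]) *: rank1 u v) = 0.
  by rewrite -scalerDl E scale1r subrr.
split.
  rewrite mulrBr mulr1 mulrDl mul1r opZr rr scalerA -addrA E2 addr0//.
rewrite mulrDr mulr1 mulrBl mul1r opZl rr scalerA.
by rewrite addrACA -opprD -addrA E2 addr0.
Qed.

(** By the factorization through Z, at most one multiple of rank1 u v destroys the
invertibility of Z. *)
Lemma unit_add_rank1 Z (u v : H) (e : R) : op_unit Z -> 0 < e ->
  exists2 c : R[i], nrm (c *: rank1 u v) < e & op_unit (Z + rank1 u v + c *: rank1 u v).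
Proof.
move=> [Y [ZY YZ]] e0.
have uZ : op_unit Z by exists Y.
have fact c : Z + rank1 u v + c *: rank1 u v = Z * (1 + rank1 u ((1 + c) *: Y v)).
  rewrite mulrDr mulr1 -addrA; congr (_ + _).
  rewrite mul_op_rank1 linearZ/= -[Z (Y v)]opME ZY op1E -scale_rank1.
  by rewrite scalerDl scale1r.
have [n0|n0] := eqVneq (1 + '[Y v, u]) 0; last first.
  exists 0; first by rewrite scale0r nrm0.
  by rewrite fact addr0 scale1r; apply: op_unitM => //; exact: rank1_unit.
have r1 : 0 < nrm (rank1 u v) + 1 by rewrite ltr_wpDl ?nrm_ge0.
pose t := e / (nrm (rank1 u v) + 1).
have t0 : 0 < t by rewrite divr_gt0.
exists t%:C.
  rewrite nrmZ nrmR gtr0_norm// /t mulrAC ltr_pdivrMr// ltr_pM2l//.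
  by rewrite ltrDl.
rewrite fact; apply: op_unitM => //; apply: rank1_unit.
rewrite innerZl mulrDl mul1r addrA n0 add0r mulf_neq0//.
  by apply/eqP => -[/eqP]; rewrite gt_eqF.
by apply: contra_eq_neq n0 => ->; rewrite addr0 oner_neq0.
Qed.

(** The finite rank part is added to the invertible one term at a time, each rank
one term being slightly rescaled if needed. *)
Lemma weyl_approx_unit V : weyl V -> forall e : R, 0 < e ->
  exists F, [/\ finrank F, nrm F < e & op_unit (V + F)].
Proof.
move=> [Z uZ /eqfinP[G [s ->] ->]].
elim: s Z uZ => [|[u v] s IH] Z uZ e e0.
  exists 0; split; [exact: finrank0|by rewrite nrm0|].
  by rewrite big_nil !addr0.
have e20 : 0 < e / 2 by rewrite divr_gt0.
have [c c2 uZ1] := unit_add_rank1 u v uZ e20.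
have [F [fF F2 uF]] := IH _ uZ1 _ e20.
exists (c *: rank1 u v + F); split.
- by apply: finrankD => //; exact/finrankZ/finrank_rank1.
- by rewrite (le_lt_trans (nrmD _ _))// [e]splitr ltrD.
- move: uF; rewrite big_cons/=; congr op_unit.
  by rewrite !addrA; congr (_ + _); rewrite addrAC.
Qed.

(** The perturbation of V that vanishes on the range of the projection P, where it
is then replaced with eps S.  In the application V P is small, so that this
operator is near V. *)
Section push.
Context (V X S P : 'B(H)) (eps : R).
Hypotheses (eps0 : 0 < eps) (X1 : nrm X <= 1) (S1 : nrm S <= 1).
Hypotheses (XP : X * P = X) (PX : P * X = X) (SX : S * X = P).
Hypotheses (SP : S * P = S) (PS : P * S = S) (PP : P * P = P).
Hypothesis (PE : 0 < essnorm (P - X * S)).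
Hypothesis (VP0 : essnorm (V * P) = 0).

Let T := V - V * P + eps%:C *: S.

Let VPS : (V - V * P) * S = 0.
Proof. by rewrite mulrBl -mulrA PS subrr. Qed.

(** V - V P - z is Z modulo finite rank, because V P is essentially zero.  As it
acts as - z on the range of S, the product Z S is - z S. *)
Lemma push_eqfin (z : R[i]) : z != 0 -> weyl (V - z%:op) ->
  exists2 Z, op_unit Z & eqfin (T - z%:op) (Z * (1 - (eps%:C / z) *: S)).
Proof.
move=> z0 wV.
have [d d0 dH] := weyl_near wV.
have [Z uZ VZ] : weyl (V - z%:op + - (V * P)).
  by apply: dH; rewrite (le_lt_trans (essnormN _))// VP0.
have ZS : eqfin (Z * S) (- (z *: S)).
  by rewrite -VZ addrAC mulrBl VPS sub0r op_scaleMl.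
exists Z => //; set c := eps%:C / z.
have -> : T - z%:op = V - z%:op - V * P + eps%:C *: S.
  by rewrite /T addrAC; congr (_ + _); rewrite addrAC.
have -> : Z * (1 - c *: S) = Z - c *: (Z * S) by rewrite mulrBr mulr1 opZr.
have -> : eps%:C *: S = - (c *: - (z *: S)).
  by rewrite scalerN scalerA divfK// opprK.
apply: eqfinD => //; apply: eqfinN; apply: eqfinZ; by symmetry.
Qed.

Lemma push_weyl (z : R[i]) : eps < nrm z -> weyl (V - z%:op) -> weyl (T - z%:op).
Proof.
move=> ez wV; have z0 : z != 0.
  by apply/eqP => z0; move: ez; rewrite z0 nrm0 ltNge (ltW eps0).
have [Z uZ ->] := push_eqfin z0 wV.
apply: weylM; first exact: op_unit_weyl.
apply/op_unit_weyl/neumann; rewrite nrmZ nrmM nrmV nrmR gtr0_norm//.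
have nz := nrm_gt0 z0.
apply: (@le_lt_trans _ _ (eps / nrm z)); last by rewrite ltr_pdivrMr// mul1r.
by rewrite ler_piMr// divr_ge0 ?ltW.
Qed.

(** With w = eps / z, of modulus greater than 1, and D = 1 - w S, the operator
T - z is Z D modulo finite rank.  Put N = (1 - w^-1 X)^-1, and let E be the
projection onto the kernel of S in the range of P.  A right inverse of D is
1 - P - w^-1 X N, and N E maps into the kernel of D. *)
Lemma push_not_weyl_near (z : R[i]) : z != 0 -> nrm z < eps -> weyl (V - z%:op) ->
  exists2 d : R, 0 < d & forall E, essnorm E < d -> ~ weyl (T - z%:op + E).
Proof.
move=> z0 ze wV; have [Z [Y [ZY YZ]] TZ] := push_eqfin z0 wV.
pose w := eps%:C / z; have w0 : w != 0.
  rewrite mulf_neq0 ?invr_eq0//; apply/eqP => -[/eqP]; rewrite gt_eqF//.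
have nz := nrm_gt0 z0.
have [|N [iN _]] := @neumann _ _ (w^-1 *: X).
  rewrite nrmZ /w invf_div nrmM nrmV nrmR gtr0_norm//.
  apply: (@le_lt_trans _ _ (nrm z / eps)); last by rewrite ltr_pdivrMr// mul1r.
  by rewrite ler_piMr// divr_ge0 ?ltW.
pose D := 1 - w *: S.
have DQ : D * (1 - P - w^-1 *: (X * N)) = 1.
  have D1 : D * (1 - P) = 1 - P.
    by rewrite /D mulrBl mul1r opZl mulrBr mulr1 SP subrr scaler0 subr0.
  have D2 : D * (X * N) = - (w *: P).
    rewrite mulrA /D mulrBl mul1r opZl SX.
    have -> : X - w *: P = - (w *: (P * (1 - w^-1 *: X))).
      by rewrite mulrBr mulr1 opZr PX scalerBr scalerA mulfV// scale1r opprB.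
    by rewrite mulNr opZl -mulrA iN mulr1.
  by rewrite mulrBr D1 opZr D2 scalerN scalerA mulVf// scale1r opprK subrK.
pose E := P - X * S.
have SE : S * E = 0 by rewrite /E mulrBr SP mulrA SX PS subrr.
have PEE : P * E = E by rewrite /E mulrBr PP mulrA PX.
have NE : N * E = E + w^-1 *: (X * (N * E)).
  by rewrite -{2}[E]mul1r -iN !mulrBl mul1r !opZl -!mulrA subrK.
have DNE : D * (N * E) = 0.
  have PNE : P * (N * E) = N * E.
    by rewrite {1}NE mulrDr PEE opZr mulrA PX -NE.
  have SNE : S * (N * E) = w^-1 *: (N * E).
    by rewrite {1}NE mulrDr SE add0r opZr mulrA SX PNE.
  by rewrite /D mulrBl mul1r opZl SNE scalerA mulfV// scale1r subrr.
apply: (@not_weyl_near _ ((1 - P - w^-1 *: (X * N)) * Y) (N * E)).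
- by rewrite TZ -mulrA (mulrA (1 - _)) DQ mul1r ZY.
- by rewrite TZ -mulrA DNE mulr0.
- have := essnormM (1 - w^-1 *: X) (N * E); rewrite mulrA iN mul1r.
  have := essnorm_ge0 (N * E); rewrite le_eqVlt => /orP[/eqP <-|//].
  by rewrite mulr0 leNgt PE.
Qed.

Lemma push_factor : T - eps%:C%:op = (V - V * P - eps%:C%:op) * (1 - S).
Proof.
rewrite mulrBr mulr1 mulrBl VPS sub0r op_scaleMl opprK /T.
by rewrite addrAC.
Qed.

Lemma push_dense_range : op_unit (V - V * P - eps%:C%:op) ->
  dense_range (1 - S) -> dense_range (T - eps%:C%:op).
Proof. by move=> uZ d1S; rewrite push_factor; exact: dense_range_unitM. Qed.

Lemma push_dense_range_adjoint : op_unit (V - V * P - eps%:C%:op) ->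
  dense_range (1 - adjoint S) -> dense_range (adjoint (T - eps%:C%:op)).
Proof.
move=> uZ d1X; rewrite push_factor adjointM (adjointB 1) adjoint1.
by apply: dense_range_Munit => //; exact: op_unit_adjoint.
Qed.

End push.

(** The perturbation argument, with the top point translated to the origin. *)
Lemma push_exists V (e : R) : 0 < e -> infinite_dimensional H ->
  ~ weyl V -> (forall z : R[i], 0 < complex.Re z -> weyl (V - z%:op)) ->
  exists T (eps : R), [/\ nrm (T - V) < e, 0 < eps,
    dense_range (T - eps%:C%:op) /\ dense_range (adjoint (T - eps%:C%:op)),
    forall z : R[i], 0 < complex.Re z -> eps < nrm z -> weyl (T - z%:op) &
    forall t : R, 0 < t < eps -> exists2 d : R, 0 < d &
      forall E, essnorm E < d -> ~ weyl (T - t%:C%:op + E)].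
Proof.
move=> e0 Hinf nV0 wV0; pose eps := e / 4; have eps0 : 0 < eps by rewrite divr_gt0.
have [|F [fF Fe uF]] := @weyl_approx_unit (V - eps%:C%:op) _ eps eps0.
  exact: wV0.
pose V' := V + F.
have VV' : eqfin V' V by exact: eqfin_add.
have uV' : op_unit (V' - eps%:C%:op) by rewrite /V' addrAC.
have nV' : ~ weyl V' by rewrite VV'.
have wV' z : 0 < complex.Re z -> weyl (V' - z%:op).
  by move=> /wV0; rewrite VV'.
have [d d0 dH] := op_unit_near uV'.
(* The images of the basis vectors sum up to at most 2 c, which is less than eps
to keep the perturbation small, and less than the distance d up to which
V' - eps remains invertible. *)
pose c := minr eps d / 4.
have c0 : 0 < c by rewrite divr_gt0// lt_min eps0.
have [n s|x ox xP] := @orthonormal_choice R H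
    (fun n x => nrm (V' x) <= c * (1 / 2) ^+ n).
  have cn0 : 0 < c * (1 / 2) ^+ n by rewrite mulr_gt0// exprn_gt0//; lra.
  have [|x [x1 xs xc]] := approx_kernel nV' _ s cn0.
    move=> r r0; exists (r / 2); first by apply/andP; split; lra.
    by apply: wV'; rewrite /= divr_gt0.
  by exists x; split=> //; exact: ltW.
have oy : orthonormal (fun n => x n.*2.+1).
  by move=> m n; rewrite ox eqSS -!muln2 eqn_pmul2r.
have [X X1 Xx] := series_op_exists ox oy.
pose P := series_proj X; pose S := adjoint X.
have S1 : nrm S <= 1 by rewrite (le_trans (nrm_adjoint _)).
have VPn : nrm (V' * P) <= 2 * c.
  have := nrm_proj_tail ox oy Xx 0 (ltW c0) xP.
  by rewrite big_geq// subr0 expr0 mulr1.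
have ce : 2 * c < eps.
  have : minr eps d <= eps by rewrite ge_min lexx.
  by rewrite /c; lra.
have cd : 2 * c < d.
  have : minr eps d <= d by rewrite ge_min lexx orbT.
  by rewrite /c; lra.
have VP0 : essnorm (V' * P) = 0 := essnorm_proj_summable ox oy Xx (ltW c0) xP.
have uZ : op_unit (V' - V' * P - eps%:C%:op).
  by rewrite addrAC; apply: dH; rewrite nrmN (le_lt_trans VPn).
have XP : X * P = X := shiftXP ox Xx.
have PX : P * X = X := shiftPX ox Xx.
have SP : S * P = S := shiftSP ox Xx.
have PS : P * S = S := shiftPS ox Xx.
have PP : P * P = P := proj_idem ox oy Xx.
have PE : 0 < essnorm (P - X * S) := lt_le_trans ltr01 (shift_defect ox Xx).
exists (V' - V' * P + eps%:C *: S), eps; split=> //.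
- have -> : V' - V' * P + eps%:C *: S - V = F - V' * P + eps%:C *: S.
    rewrite addrAC; congr (_ + _); rewrite addrAC; congr (_ - _).
    by rewrite /V' addrAC subrr add0r.
  rewrite (le_lt_trans (nrmD _ _))// nrmZ nrmR gtr0_norm//.
  have h1 := nrmB F (V' * P); have h2 : eps * nrm S <= eps by rewrite ler_piMr// ltW.
  have : e = 4 * eps by rewrite /eps; field.
  by lra.
- split; first exact: (push_dense_range PS uZ (dense_range_1S ox Xx)).
  apply: (push_dense_range_adjoint PS uZ); rewrite adjointK.
  exact: (dense_range_1X ox Xx).
- by move=> z z0 ez; apply: push_weyl => //; exact: wV'.
- move=> t /andP[t0 te]; apply: (push_not_weyl_near (X := X) (P := P)) => //.
  + by apply/eqP => -[/eqP]; rewrite gt_eqF.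
  + by rewrite nrmR gtr0_norm.
  + exact: wV'.
Qed.

End perturbation.

(** * The top of the Weyl spectrum *)

Section top.
Context {R : realType} {H : hilbertType R}.
Implicit Types (S T V : 'B(H)) (z w : R[i]).

Lemma weyl_large T z : nrm T < nrm z -> weyl (T - z%:op).
Proof.
move=> Tz; have nz : 0 < nrm z := le_lt_trans (nrm_ge0 _) Tz.
have z0 : z != 0 by apply/eqP => z0; move: nz; rewrite z0 nrm0 ltxx.
have -> : T - z%:op = - z *: (1 - z^-1 *: T).
  by rewrite scalerBr scalerA mulNr mulfV// scaleN1r opprK scaleNr addrC.
apply/op_unit_weyl/op_unitZ; first by rewrite oppr_eq0.
by apply: neumann; rewrite nrmZ nrmV mulrC ltr_pdivrMr// mul1r.
Qed.

Lemma nrm_op_scalar z : nrm (z%:op : 'B(H)) <= nrm z.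
Proof. by rewrite nrmZ ler_piMr ?nrm_ge0 ?nrm_1. Qed.

(** The joint openness, in the operator and the scalar, of being Weyl. *)
Lemma weyl_near_shift T z : weyl (T - z%:op) -> exists2 d : R, 0 < d &
  forall T' w, nrm (T' - T) < d -> nrm (w - z) < d -> weyl (T' - w%:op).
Proof.
move=> /weyl_near[d d0 dH]; exists (d / 2); first by rewrite divr_gt0.
move=> T' w TT wz.
rewrite (_ : _ - _ = T - z%:op + ((T' - T) - (w - z)%:op)); last first.
  by rewrite scalerBl opprB addrACA [T + _]addrC subrK addKr.
apply: dH; rewrite (le_lt_trans (essnorm_le_nrm _))//.
rewrite (le_lt_trans (nrmB _ _))// [d]splitr ltrD//.
exact: le_lt_trans (nrm_op_scalar _) wz.
Qed.

Definition top_weyl T z := ~ weyl (T - z%:op) /\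
  forall w, complex.Re z < complex.Re w -> weyl (T - w%:op).

(** A nonempty compact set has a point of largest real part. *)
Lemma top_weyl_exists T : infinite_dimensional H -> exists z, top_weyl T z.
Proof.
move=> Hinf; have [z0 nz0] := ess_spectrum_nonempty T (essnorm1_gt0 Hinf).
pose W := [set complex.Re z | z in [set z | ~ weyl (T - z%:op)]].
have inB z : ~ weyl (T - z%:op) -> nrm z <= nrm T.
  by move=> nz; rewrite leNgt; apply/negP => /weyl_large.
have supW : has_sup W.
  split; first by exists (complex.Re z0), z0.
  exists (nrm T) => _ [z nz <-].
  by rewrite (le_trans (Re_le_nrm _))// inB.
have leW z : ~ weyl (T - z%:op) -> complex.Re z <= sup W.
  by move=> nz; apply: sup_upper_bound => //; exists z.
apply: contrapT => notop.
have ltW' z : ~ weyl (T - z%:op) -> complex.Re z < sup W.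
  move=> nz; rewrite lt_neqAle leW// andbT; apply/eqP => zW; apply: notop.
  exists z; split=> // w; rewrite zW => Ww; apply: contrapT => /leW.
  by rewrite leNgt Ww.
have [||c Hc] := @disc_uniform R (nrm T) (fun w c => ~ weyl (T - w%:op) ->
    0 < c /\ complex.Re w <= sup W - c^-1).
- move=> z _; have [wz|nz] := pselect (weyl (T - z%:op)).
    have [d d0 dH] := weyl_near_shift wz; exists d => //; exists 0 => w wzd nw.
    by exfalso; apply: nw; apply: dH => //; rewrite subrr nrm0.
  have zs := ltW' _ nz; exists ((sup W - complex.Re z) / 2).
    by rewrite divr_gt0// subr_gt0.
  exists ((sup W - complex.Re z) / 2)^-1 => w wz _; split.
    by rewrite invr_gt0 divr_gt0// subr_gt0.
  rewrite invrK; have := Re_le_nrm (w - z); rewrite raddfB/=; lra.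
- move=> w c c' cc' h /h[c0 wc]; split; first exact: lt_le_trans cc'.
  rewrite (le_trans wc)// lerD2l lerN2 lef_pV2 ?posrE//.
  exact: lt_le_trans cc'.
have [c0 _] := Hc z0 (inB _ nz0) nz0.
have : sup W <= sup W - c^-1.
  apply: ge_sup; first by exists (complex.Re z0), z0.
  by move=> _ [z nz <-]; have [] := Hc z (inB _ nz) nz.
by rewrite lerBrDr gerDl leNgt invr_gt0 c0.
Qed.

(** The cap cut off the disc of center 0 and radius eps by the line Re z = s
shrinks to the point eps as s tends to eps, for |z - eps|^2 is at most
2 eps (eps - s) on it. *)
Lemma cap_small (eps r : R) : 0 < eps -> 0 < r -> exists2 s : R, 0 < s < eps &
  forall z, s <= complex.Re z -> nrm z <= eps -> nrm (z - eps%:C) < r.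
Proof.
move=> e0 r0; pose s := maxr (eps / 2) (eps - r ^+ 2 / (4 * eps)).
have s1 : eps / 2 <= s by rewrite le_max lexx.
have s2 : eps - r ^+ 2 / (4 * eps) <= s by rewrite le_max lexx orbT.
have q0 : 0 < r ^+ 2 / (4 * eps) by rewrite divr_gt0 ?exprn_gt0// mulr_gt0.
exists s.
  rewrite gt_max (lt_le_trans _ s1) ?divr_gt0//=; apply/andP; split; lra.
move=> z sz ze; rewrite -(@ltr_pXn2r _ 2)// ?nnegrE ?nrm_ge0 ?(ltW r0)//.
have nE w : nrm w ^+ 2 = complex.Re w ^+ 2 + complex.Im w ^+ 2.
  by rewrite nrm.unlock normc_def/= sqr_sqrtr// addr_ge0 ?sqr_ge0.
have : nrm z ^+ 2 <= eps ^+ 2 by rewrite ler_pXn2r ?nnegrE ?nrm_ge0 ?(ltW e0).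
rewrite !nE raddfB/= raddfB/= subr0 => h.
have : r ^+ 2 = 4 * eps * (r ^+ 2 / (4 * eps)).
  by rewrite mulrC divfK// mulf_neq0// gt_eqF.
have h2 := ler_wpM2l (ltW e0) (le_trans s2 sz).
have : 0 < eps * (r ^+ 2 / (4 * eps)) by rewrite mulr_gt0.
nra.
Qed.

(** Points l + t with t close to eps persist in the Weyl spectra of the operators
near T, and force the top points to the right of the line through l + t.  To the
right of this line and away from l + eps lie only Weyl values of T, and by
compactness they remain Weyl for all operators near T at once. *)
Lemma top_weyl_stable T l (eps : R) : 0 < eps ->
  (forall z, 0 < complex.Re z -> eps < nrm z -> weyl (T - (l + z)%:op)) ->
  (forall t : R, 0 < t < eps -> exists2 d : R, 0 < d &
     forall E, essnorm E < d -> ~ weyl (T - (l + t%:C)%:op + E)) ->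
  forall r : R, 0 < r -> exists2 d : R, 0 < d & forall T' l',
    nrm (T' - T) < d -> top_weyl T' l' -> nrm (l' - (l + eps%:C)) < r.
Proof.
move=> e0 out inn r r0.
have [s /andP[s0 se] cap] := cap_small e0 r0.
have [|d1 d10 H1] := inn s; first by rewrite s0.
have [||c Hc] := @disc_uniform R (nrm T + 1) (fun w c => 0 < c /\
    (s <= complex.Re (w - l) -> r <= nrm (w - (l + eps%:C)) ->
     forall T', nrm (T' - T) * c < 1 -> weyl (T' - w%:op))).
- move=> z _; have [zs|sz] := ltP (complex.Re (z - l)) s.
    exists (s - complex.Re (z - l)); first by rewrite subr_gt0.
    exists 1 => w wz; split=> // sw.
    have := Re_le_nrm (w - z); move: sw zs wz; rewrite !raddfB/=; lra.
  have [zr|rz] := ltP (nrm (z - (l + eps%:C))) r.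
    exists (r - nrm (z - (l + eps%:C))); first by rewrite subr_gt0.
    exists 1 => w wz; split=> // _ rw.
    by have := nrm_tri z w (l + eps%:C); lra.
  have wz : weyl (T - z%:op).
    have -> : z = l + (z - l) by rewrite addrC subrK.
    apply: out; first exact: lt_le_trans sz.
    rewrite ltNge; apply/negP => /(cap _ sz).
    by rewrite -addrA -opprD ltNge rz.
  have [d d0 dH] := weyl_near_shift wz; exists d => //; exists d^-1 => w wzd.
  split; first by rewrite invr_gt0.
  by move=> _ _ T' TT; apply: dH => //; move: TT; rewrite ltr_pdivrMr// mul1r.
- move=> w c c' cc' [c0 h]; split; first exact: lt_le_trans cc'.
  move=> sw rw T' TT; apply: h => //; rewrite (le_lt_trans _ TT)//.
  by rewrite ler_wpM2l ?nrm_ge0.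
have c0 : 0 < c.
  by have [] := Hc 0; rewrite // nrm0 addr_ge0 ?nrm_ge0.
exists (minr 1 (minr d1 c^-1)).
  by rewrite !lt_min ltr01 d10 invr_gt0.
move=> T' l'; rewrite !lt_min => /and3P[t1 td tc] [nl' topl'].
have sl : s <= complex.Re (l' - l).
  rewrite leNgt; apply/negP => sl.
  apply: (H1 (T' - T)); first exact: le_lt_trans (essnorm_le_nrm _) td.
  rewrite addrAC addrCA subrr addr0; apply: topl'.
  by move: sl; rewrite raddfB raddfD/=; lra.
rewrite ltNge; apply/negP => rl; apply: nl'.
have [/weyl_large//|lT] := ltP (nrm T') (nrm l').
have lB : nrm l' <= nrm T + 1.
  by have := nrmD (T' - T) T; rewrite subrK; lra.
have [_] := Hc l' lB; apply=> //.
by rewrite -ltr_pdivlMr// div1r.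
Qed.

Definition nearly_hits (a : H) (n : nat) V := exists v, nrm (V v - a) < n.+1%:R^-1.

Lemma nearly_hits_open a n V : nearly_hits a n V ->
  exists2 d : R, 0 < d & forall V', nrm (V' - V) < d -> nearly_hits a n V'.
Proof.
move=> [v va]; have v1 : 0 < nrm v + 1 by rewrite ltr_wpDl ?nrm_ge0.
have d0 : 0 < n.+1%:R^-1 - nrm (V v - a) by rewrite subr_gt0.
exists ((n.+1%:R^-1 - nrm (V v - a)) / (nrm v + 1)); first exact: divr_gt0.
move=> V'; rewrite ltr_pdivlMr// => VV; exists v.
have := nrm_tri (V v) (V' v) a; have := nrm_op (V' - V) v.
have := nrm_ge0 (V' - V); rewrite boundedOpB.
move: (n.+1%:R^-1) (nrm (V' - V)) (nrm (V v - a)) (nrm (V' v - V v)) (nrm v)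
  (nrm (V' v - a)) VV => i d p q y r; rewrite mulrDr mulr1; lra.
Qed.

Definition top_nearly_hits a n T := forall l, top_weyl T l ->
  nearly_hits a n (T - l%:op) /\ nearly_hits a n (adjoint (T - l%:op)).

Definition stably_hits a n T := exists2 d : R, 0 < d &
  forall T', nrm (T' - T) < d -> top_nearly_hits a n T'.

Lemma stably_hits_open a n T : stably_hits a n T ->
  exists2 d : R, 0 < d & forall T', nrm (T' - T) < d -> stably_hits a n T'.
Proof.
move=> [d d0 dH]; have d20 : 0 < d / 2 by rewrite divr_gt0.
exists (d / 2) => // T' TT; exists (d / 2) => // U UT; apply: dH.
by rewrite (le_lt_trans (nrm_tri T' _ _))// [d]splitr ltrD.
Qed.

(** The operator T1 given by the perturbation has dense range at l + eps, and any
operator near T1 has its top points near l + eps, where the condition still holds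
by openness. *)
Lemma stably_hits_dense a n T (e : R) : infinite_dimensional H -> 0 < e ->
  exists2 T', nrm (T' - T) < e & stably_hits a n T'.
Proof.
move=> Hinf e0; have [l [nl topl]] := top_weyl_exists T Hinf.
have [z z0|V [eps [Ve eps0 [dr dra] out inn]]] := push_exists e0 Hinf nl.
  by rewrite -addrA -opprD -scalerDl; apply: topl; rewrite raddfD/= ltrDl.
pose T1 := V + l%:op.
have T1E z : T1 - (l + z)%:op = V - z%:op.
  by rewrite scalerDl opprD addrA addrK.
exists T1; first by move: Ve; rewrite opprB addrA.
have n0 : 0 < (n.+1%:R^-1 : R) by [].
have [d1 d10 H1] : exists2 d : R, 0 < d & forall V',
    nrm (V' - (V - eps%:C%:op)) < d -> nearly_hits a n V'.
  exact/nearly_hits_open/dr.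
have [d2 d20 H2] : exists2 d : R, 0 < d & forall V',
    nrm (V' - adjoint (V - eps%:C%:op)) < d -> nearly_hits a n V'.
  exact/nearly_hits_open/dra.
pose d := minr d1 d2 / 2.
have d0 : 0 < d by rewrite divr_gt0// lt_min d10.
have [||d3 d30 H3] := @top_weyl_stable T1 l eps eps0 _ _ d d0.
- by move=> z z0 ez; rewrite T1E; exact: out.
- by move=> t /inn[r r0 rH]; exists r => // E Er; rewrite T1E; exact: rH.
exists (minr d d3); first by rewrite lt_min d0.
move=> T'; rewrite lt_min => /andP[Td Td3] l' topl'.
have ll' := H3 T' l' Td3 topl'.
have close : nrm (T' - l'%:op - (V - eps%:C%:op)) < minr d1 d2.
  have -> : T' - l'%:op - (V - eps%:C%:op) = (T' - T1) - (l' - (l + eps%:C))%:op.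
    rewrite -(T1E eps%:C) !scalerBl !opprB addrACA [RHS]addrACA; congr (_ + _).
    exact: addrC.
  rewrite (le_lt_trans (nrmB _ _))//.
  have := nrm_op_scalar (l' - (l + eps%:C)).
  by move: Td ll'; rewrite /d; lra.
split.
  by apply: H1; rewrite (lt_le_trans close)// ge_min lexx.
apply: H2; rewrite -adjointB (le_lt_trans (nrm_adjoint _))//.
by rewrite (lt_le_trans close)// ge_min lexx orbT.
Qed.

(** An eigenvector of T at l is excluded by the dense range of the adjoint, and an
eigenvector of the adjoint by that of T - l itself. *)
Lemma top_continuous_spectrum T l : top_weyl T l ->
  dense_range (T - l%:op) -> dense_range (adjoint (T - l%:op)) ->
  continuous_spectrum T l.
Proof.
move=> [nl _] dr dra; split.
  move=> [S [SK KS]]; apply: nl; apply: op_unit_weyl; exists S.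
  by split; apply: boundedOpP => x; [exact: KS|exact: SK].
move=> [[x x0 Tx]|[m [x x0 Tx] ml]].
  by move/eqP: x0; apply; exact: (dense_range_adjoint_inj dra).
move/eqP: x0; apply; apply: (@dense_range_adjoint_inj _ _ (adjoint (T - l%:op))).
  by rewrite adjointK.
by rewrite adjointB adjointZ adjoint1 -ml conjCK.
Qed.

End top.

(** * Baire category and the conclusion *)

(** The usual nested balls, with radii at least halved at each step, converge by
completeness to a point of every F i. *)
Lemma op_baire (R : realType) (V : completeNormedModType R[i])
    (F : nat -> 'B(V) -> Prop) :
  (forall i T, F i T -> exists2 d : R, 0 < d &
     forall T', nrm (T' - T) < d -> F i T') ->
  (forall i T (e : R), 0 < e -> exists2 T', nrm (T' - T) < e & F i T') ->
  forall T (e : R), 0 < e -> exists2 T', nrm (T' - T) < e & forall i, F i T'.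
Proof.
move=> Fo Fd T e e0.
have step (p : nat * ('B(V) * R)) : exists q : 'B(V) * R, 0 < p.2.2 ->
    [/\ 0 < q.2, q.2 <= p.2.2 / 2, nrm (q.1 - p.2.1) < p.2.2 / 2 &
        forall T', nrm (T' - q.1) <= q.2 -> F p.1 T'].
  have [r0|r0] := ltP 0 p.2.2; last by exists p.2.
  have r20 : 0 < p.2.2 / 2 by rewrite divr_gt0.
  have [T' TT' FT'] := Fd p.1 p.2.1 _ r20.
  have [d d0 dH] := Fo _ _ FT'.
  exists (T', minr (p.2.2 / 2) (d / 2)) => _ /=; split=> //.
  - by rewrite lt_min r20 divr_gt0.
  - by rewrite ge_min lexx.
  - move=> U UT; apply: dH; rewrite (le_lt_trans UT)// gt_min.
    by apply/orP; right; lra.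
have [g gP] := choice step.
pose fix b n : 'B(V) * R := if n is k.+1 then g (k, b k) else (T, e / 2).
have b0 n : 0 < (b n).2.
  elim: n => [|n IH] /=; first by rewrite divr_gt0.
  by have [] := gP (n, b n) IH.
have bS n : [/\ (b n.+1).2 <= (b n).2 / 2,
    nrm ((b n.+1).1 - (b n).1) < (b n).2 / 2 &
    forall T', nrm (T' - (b n.+1).1) <= (b n.+1).2 -> F n T'].
  by have [] := gP (n, b n) (b0 n).
have br n : (b n).2 <= e / 2 * (1 / 2) ^+ n.
  elim: n => [|n IH]; first by rewrite expr0 mulr1.
  by have [h _ _] := bS n; rewrite exprS; lra.
have dist n k : nrm ((b (n + k)%N).1 - (b n).1) <= (b n).2 - (b (n + k)%N).2.
  elim: k => [|k IH]; first by rewrite addn0 !subrr nrm0.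
  rewrite addnS; have [h1 h2 _] := bS (n + k)%N.
  by have := nrm_tri (b (n + k)%N).1 (b (n + k).+1).1 (b n).1; lra.
have h01 : 0 <= (1 / 2 : R) < 1 by apply/andP; split; lra.
have e20 : 0 <= e / 2 by rewrite divr_ge0// ltW.
have [n|L HL] := @geometric_cvg _ _ (fun n => (b n).1) (e / 2) (1 / 2)
    (@op_complete _ V) h01 e20.
  by have [_ h _] := bS n; have := br n; have := b0 n; lra.
have Lb n : nrm (L - (b n).1) <= (b n).2.
  apply/ler_addgt0Pr => d d0; have [N NH] := HL _ d0.
  have := NH (n + N)%N (leq_addl _ _).
  have := nrm_tri (b (n + N)%N).1 L (b n).1; have := dist n N.
  have := b0 (n + N)%N; lra.
exists L; first by have := Lb 0; rewrite /=; lra.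
by move=> i; have [_ _] := bS i; apply; exact: Lb.
Qed.

Section topology.
Context {R : realType} {U : normedModType R[i]}.

Lemma open_nrm (A : set U) : (forall x, A x -> exists2 d : R, 0 < d &
  forall y, nrm (y - x) < d -> A y) -> open A.
Proof.
move=> Ao; rewrite openE => x /Ao[d d0 dH]; apply/nbhs_ballP.
exists d%:C; first by rewrite /= ltcR.
by move=> y; rewrite -ball_normE/= nrmE ltcR nrmC => /dH.
Qed.

Lemma dense_nrm (A : set U) :
  (forall x (e : R), 0 < e -> exists2 y, nrm (y - x) < e & A y) -> dense A.
Proof.
move=> Ad O [x Ox] oO; have : nbhs x O by exact: open_nbhs_nbhs.
move=> /nbhs_ballP[e /= e0 eO].
have re0 : 0 < complex.Re e by move: e0; rewrite ltcE => /andP[].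
have [y yx Ay] := Ad x _ re0; exists y; split=> //; apply: eO.
rewrite -ball_normE/= nrmE nrmC -(RRe_real (gtr0_real e0)) ltcR//.
Qed.

Lemma nrm_dense (A : set U) : dense A ->
  forall x (e : R), 0 < e -> exists2 y, A y & nrm (y - x) < e.
Proof.
move=> dA x e e0; have e0C : 0 < e%:C :> R[i] by rewrite ltcR.
have [|y [yx Ay]] := dA (ball x e%:C) _ (ball_open _ _).
  by exists x; exact: ballxx.
by exists y => //; move: yx; rewrite -ball_normE/= nrmE ltcR nrmC.
Qed.

End topology.

Theorem theorem1p2 (R : realType) (H : hilbertType R)
    (H_separable : separable_space H)
    (H_infinite : infinite_dimensional H) :
  comeager [set T : 'B(H) | continuous_spectrum T !=set0].
Proof.
have [A cA dA] := H_separable.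
have [f fA] : exists f : nat -> H, A `<=` range f.
  by have /pcard_surjP[f sf] := cA; exists f.
(* The pairs (index of a vector, n) are enumerated by their codes; the default
value for the integers that encode no pair only repeats a condition. *)
pose F (i : nat) : set 'B(H) :=
  let p := odflt (0%N, 0%N) (unpickle i) in stably_hits (f p.1) p.2.
exists (\bigcap_i F i); first split.
- exists F => // i; apply: open_nrm => T; exact: stably_hits_open.
- apply: dense_nrm => T e e0.
  have [||T' TT' FT'] := @op_baire R H F _ _ T e e0.
  + by move=> i U; exact: stably_hits_open.
  + by move=> i U r r0; exact: stably_hits_dense.
  by exists T' => // i _; exact: FT'.
move=> T FT; have [l topl] := top_weyl_exists T H_infinite.
exists l.
have hits i n : nearly_hits (f i) n (T - l%:op) /\
    nearly_hits (f i) n (adjoint (T - l%:op)).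
  have [d d0 dH] := FT (pickle (i, n)) I; move: dH.
  by rewrite pickleK/= => /(_ T); rewrite subrr nrm0 => /(_ d0)/(_ l topl).
have dense V : (forall i n, nearly_hits (f i) n V) -> dense_range V.
  move=> hV a e e0; have e20 : 0 < e / 2 by rewrite divr_gt0.
  have [_ /fA[i _ <-] ia] := nrm_dense dA a e20.
  have [n ne] : exists n, n.+1%:R^-1 < e / 2.
    have [N _ NH] := near_infty_natSinv_lt (PosNum e20).
    by exists N; exact: (NH N (leqnn N)).
  have [v vi] := hV i n; exists v.
  rewrite (le_lt_trans (nrm_tri (f i) _ _))// [e]splitr ltrD//.
  exact: lt_trans ne.
by apply: top_continuous_spectrum => //; apply: dense => i n; have [] := hits i n.
Qed.
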